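(* Let $m\ge1$, $p>0$ and $k\ge0$ be integers. The space $V_{(m)}^{\frac{-p}{\sqrt{2m}}+k\sqrt{2m}}(p)$ has a basis consisting of the vectors $$\widehat J_\mu(m;\mathbf x),\qquad \mu\subset\big((p-(k-1)m-1)^k\big),$$ i.e. $\mu$ runs over all partitions whose Young diagram is contained in the rectangular diagram with $k$ rows of length $p-(k-1)m-1$.
   Context: Fix an integer $m\ge 1$. Let $H$ be the Heisenberg Lie algebra with basis $h_i$, $i\in\mathbb Z$, $[h_i,h_j]=i\,\delta_{i+j,0}$ (the central element acts as $1$). For a scalar $\lambda$ let $H_\lambda$ be the highest weight (Fock) representation with highest weight vector $|\lambda\rangle$: $h_i|\lambda\rangle=0$ for $i>0$, $h_0|\lambda\rangle=\lambda|\lambda\rangle$, and $H_\lambda=\mathbb C[h_{-1},h_{-2},\ldots]|\lambda\rangle$ is free over $\mathbb C[h_{-1},h_{-2},\ldots]$. For $0\le i\le 2m-1$ put $L_{(m),i}=\bigoplus_{n\in\mathbb Z}H_{(2nm+i)/\sqrt{2m}}$. On $\bigoplus_i L_{(m),i}$ the bosonic vertex operator is $$\phi_{\sqrt{2m}}(z)=\exp\Big(\sqrt{2m}\sum_{n>0}\tfrac{h_{-n}}{n}z^n\Big)\exp\Big(-\sqrt{2m}\sum_{n>0}\tfrac{h_{n}}{n}z^{-n}\Big)\,T\,z^{\sqrt{2m}\,h_0}=\sum_{n\in\mathbb Z}a_nz^{-n-1},$$ where $T$ commutes with all $h_i$, $i\ne0$, and $T|\lambda\rangle=|\lambda+\sqrt{2m}\rangle$.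 The operators $a_n$ pairwise commute. Put $v_p=\left|\frac{-p}{\sqrt{2m}}\right\rangle$; then $a_iv_p=0$ for $i\ge p$. For $p>0$ let $V_{(m)}(p)=\mathbb C[a_{p-1},a_{p-2},\ldots,a_0]\cdot v_p$, and let $V_{(m)}^{c}(p)=\{v\in V_{(m)}(p): h_0v=cv\}$. Jack polynomials: let $\Lambda=\mathbb C[p_1,p_2,\ldots]$ be the algebra of symmetric functions in $x_1,x_2,\ldots$, $p_k=\sum_ix_i^k$. For a coupling constant $\alpha$ the scalar product $\langle\cdot,\cdot\rangle_\alpha$ on $\Lambda$ has the products of power sums as an orthogonal basis, with $\langle p_1^{i_1}\cdots p_k^{i_k},p_1^{i_1}\cdots p_k^{i_k}\rangle_\alpha=\alpha^{-\sum_s i_s}\prod_{s=1}^k s^{i_s}i_s!$. The Jack polynomials $J_\lambda(\alpha;\mathbf x)$ ($\lambda$ a partition) are uniquely determined by $J_\lambda=m_\lambda+\sum_{\mu<\lambda}v_{\lambda,\mu}(\alpha)m_\mu$ and $\langle J_\lambda,J_\mu\rangle_\alpha=0$ for $\lambda\neq\mu$, where $m_\lambda$ are the monomial symmetric functions and $\mu\le\lambda$ is the dominance order on partitions of the same size. For each scalar $s$ identify $H_s$ with $\Lambda$ by the linear isomorphism $I:\ h_{-i_1}\cdots h_{-i_k}|s\rangle\mapsto\left(\sqrt{m/2}\right)^kp_{i_1}\cdots p_{i_k}$ ($i_\alpha>0$). Put $\widehat J_\lambda(m;\mathbf x)=I^{-1}(J_\lambda(m;\mathbf x))$; in the claim it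 is taken in $H_s$ with $s=\frac{-p}{\sqrt{2m}}+k\sqrt{2m}$. $(N^k)$ denotes the partition $(N,\ldots,N)$ with $k$ parts; for $k=0$ it is the empty partition; if $k\ge1$ and $N<0$, no partition $\mu$ satisfies $\mu\subset(N^k)$ by convention. *)

(* Defs.v *)
From HB Require Import structures.
From mathcomp Require Import all_boot all_order all_algebra.
From mathcomp Require Import finmap.
From mathcomp.multinomials Require Import mpoly.
From mathcomp.multinomials Require Import monalg.

Set Implicit Arguments.
Unset Strict Implicit.
Unset Printing Implicit Defensive.

Import Order.TTheory GRing.Theory Num.Theory.

Local Open Scope ring_scope.

HB.lock Definition linext (C : nzRingType) (K : choiceType) (V : lmodType C)
  (f : K -> V) (g : {malg C[K]}) : V := \sum_(x <- msupp g) mcoeff x g *: f x.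

Lemma mcoeff_linext_diag (C : comNzRingType) (K : choiceType) (h : K -> C)
    (f : {malg C[K]}) x :
  mcoeff x (linext (fun y => h y *: (<< y >> : {malg C[K]})) f) = h x * mcoeff x f.
Proof.
rewrite linext.unlock (raddf_sum (mcoeff x)) [in RHS](monalgE f).
rewrite [in RHS](raddf_sum (mcoeff x)) mulr_sumr.
apply: eq_bigr => y _ /=; rewrite !mcoeffZ !mcoeffU.
by case: eqP => [->|_]; rewrite ?(mulr1n, mulr0n, mulr1, mulr0) // mulrC.
Qed.

Section LinearAlgebra.
Variable C : nzRingType.

Definition in_span (V : lmodType C) (S : V -> Prop) (v : V) : Prop :=
  exists n (c : 'I_n -> C) (u : 'I_n -> V),
    (forall i, S (u i)) /\ v = \sum_(i < n) c i *: u i.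

Definition is_basis (I : choiceType) (V : lmodType C)
    (P : pred I) (u : I -> V) (W : V -> Prop) : Prop :=
  [/\ forall i, P i -> W (u i),
      forall (s : seq I) (c : I -> C), uniq s -> all P s ->
        \sum_(i <- s) c i *: u i = 0 -> forall i, i \in s -> c i = 0
    & forall v, W v -> exists (s : seq I) (c : I -> C),
        all P s /\ v = \sum_(i <- s) c i *: u i].

End LinearAlgebra.

Section Partitions.

Record intpart := IntPart {
  parts :> seq nat;
  _ : sorted geq parts && (0%N \notin parts) }.

HB.instance Definition _ := [isSub for parts].
HB.instance Definition _ := [Choice of intpart by <:].

Definition dominates (l u : intpart) : Prop :=
  sumn u = sumn l /\ forall i, (sumn (take i u) <= sumn (take i l))%N.

(* The diagram of [u] lies in the rectangle with [k] rows of length [N].  For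
   [0 < k] and [N < 0] this is false for every [u], since [nth 0 u 0] is a
   natural number. *)
Definition in_rect (N : int) (k : nat) (u : intpart) : bool :=
  (size u <= k)%N && [forall i : 'I_k, (nth 0%N u i)%:Z <= N].

End Partitions.

(* Polynomials in countably many variables; the variable of index [n] is the
   power sum p_(n+1) when [poly_inf] is the algebra of symmetric functions, and
   h_(-(n+1)) when it is a Fock representation H_s. *)
Notation poly_inf C := {malg C[{cmonom nat}]}.

(* The direct sum of the H_(j / sqrt (2m)) over all integers [j], that is, of
   L_((m), 0), ..., L_((m), 2m - 1).  The basis vector of index [(j, M)] is
   M(h_(-1), h_(-2), ...) | j / sqrt (2m) >. *)
Notation fock_sum C := {malg C[(int * {cmonom nat})%type]}.

HB.lock Definition basis_vec (C : numClosedFieldType) (j : int)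
  (M : {cmonom nat}) : fock_sum C := << (j, M) >>.

Section Fock.
Variable C : numClosedFieldType.

Definition weight (m : nat) (j : int) : C := j%:~R / sqrtC (2 * m)%:R.

Definition vac (j : int) : fock_sum C := basis_vec C j mone.

(* h_n acts on C[h_(-1), h_(-2), ...] | s > as multiplication by h_n for n < 0
   and as n d/dh_(-n) for n > 0. *)
Definition heis (m : nat) (n : int) : fock_sum C -> fock_sum C :=
  linext (fun x : int * {cmonom nat} =>
    match n with
    | Negz k => basis_vec C x.1 (mmul (ucm k) x.2)
    | Posz 0 => weight m x.1 *: basis_vec C x.1 x.2
    | Posz k.+1 => (k.+1 * x.2 k)%:R *: basis_vec C x.1 (divcm x.2 (ucm k))
    end : fock_sum C).

Definition shiftT (m : nat) : fock_sum C -> fock_sum C :=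
  linext (fun x : int * {cmonom nat} => basis_vec C (x.1 + (2 * m)%:Z) x.2).

(* Formal power series with operator coefficients. *)
Definition opser := nat -> fock_sum C -> fock_sum C.

Definition opser1 : opser := fun n v => if n == 0%N then v else 0.

Definition opser_mul (X Y : opser) : opser :=
  fun n v => \sum_(i < n.+1) X i (Y (n - i)%N v).

(* The exponential of a series without constant term: X^k contributes to the
   coefficient of degree [n] only for k <= n. *)
Definition opser_exp (X : opser) : opser :=
  fun n v => \sum_(k < n.+1) (k`!%:R)^-1 *: iter k (opser_mul X) opser1 n v.

(* The exponents of the two exponentials of the vertex operator, as series in
   z and in z^-1 respectively. *)
Definition creation (m : nat) : opser := fun n v =>
  if n == 0%N then 0 else (sqrtC (2 * m)%:R / n%:R) *: heis m (- n%:Z) v.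

Definition annihilation (m : nat) : opser := fun n v =>
  if n == 0%N then 0 else - (sqrtC (2 * m)%:R / n%:R) *: heis m n%:Z v.

Definition mwgt (M : {cmonom nat}) : nat :=
  (\sum_(n <- finsupp M) n.+1 * M n)%N.

(* a_n, the coefficient of z^(-n-1) in the vertex operator.  On the vector of
   index [(j, M)] the factor z^(sqrt (2m) h_0) is z^j, so the terms of degree r
   in z and s in z^-1 of the exponentials contribute when r - s + j = - n - 1;
   the annihilating exponential has no term of degree s > [mwgt M]. *)
Definition mode (m : nat) (n : int) : fock_sum C -> fock_sum C :=
  linext (fun x : int * {cmonom nat} =>
    \sum_(s < (mwgt x.2).+1)
      if s%:Z - x.1 - n - 1 is Posz r then
        opser_exp (creation m) r
          (opser_exp (annihilation m) s (shiftT m (basis_vec C x.1 x.2)))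
      else 0 : fock_sum C).

(* C[a_(p-1), ..., a_0] v_p: the algebra generated by the a_i is spanned by
   words in them. *)
Definition Vspace (m p : nat) : fock_sum C -> Prop :=
  in_span (fun u => exists w : seq 'I_p,
    u = foldr (fun (i : 'I_p) v => mode m (i : nat)%:Z v) (vac (- p%:Z)) w).

Definition Vweight (m p : nat) (c : C) (v : fock_sum C) : Prop :=
  Vspace m p v /\ heis m 0 v = c *: v.

(* The isomorphism I from H_s to symmetric functions; H_s is embedded in
   [fock_sum] by [in_charge]. *)
Definition symI (m : nat) : poly_inf C -> poly_inf C :=
  linext (fun M : {cmonom nat} =>
    sqrtC (m%:R / 2%:R) ^+ mdeg M *: (<< M >> : poly_inf C)).

Definition symIinv (m : nat) : poly_inf C -> poly_inf C :=
  linext (fun M : {cmonom nat} =>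
    sqrtC (m%:R / 2%:R) ^- mdeg M *: (<< M >> : poly_inf C)).

Lemma symIinvK (m : nat) : (0 < m)%N -> cancel (symIinv m) (symI m).
Proof.
move=> m_gt0 f; apply/malgP => M; rewrite !mcoeff_linext_diag mulrA divff ?mul1r //.
by rewrite expf_neq0 // sqrtC_eq0 mulf_neq0 ?invr_eq0 // pnatr_eq0 -?lt0n.
Qed.

Lemma symIK (m : nat) : (0 < m)%N -> cancel (symI m) (symIinv m).
Proof.
move=> m_gt0 f; apply/malgP => M; rewrite !mcoeff_linext_diag mulrA mulVf ?mul1r //.
by rewrite expf_neq0 // sqrtC_eq0 mulf_neq0 ?invr_eq0 // pnatr_eq0 -?lt0n.
Qed.

Definition in_charge (j : int) : poly_inf C -> fock_sum C :=
  linext (fun M : {cmonom nat} => basis_vec C j M).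

End Fock.

Section Jack.
Variable C : numClosedFieldType.

(* Bilinear, with the products of power sums orthogonal; [psum_norm a M] is the
   square norm of the product of power sums with exponents [M]. *)
Definition psum_norm (a : C) (M : {cmonom nat}) : C :=
  a ^- mdeg M * (\prod_(n <- finsupp M) (n.+1 ^ M n * (M n)`!))%N%:R.

Definition jack_form (a : C) (f g : poly_inf C) : C :=
  \sum_(M <- msupp f) mcoeff M f * mcoeff M g * psum_norm a M.

(* The image of a symmetric function in n variables, x_i = 0 for i >= n. *)
Definition psum (n k : nat) : mpoly.mpoly n C :=
  \sum_(i < n) mpoly.mpolyX C (mpoly.mnm1 i) ^+ k.

Definition restr (n : nat) (f : poly_inf C) : mpoly.mpoly n C :=
  linext (fun M : {cmonom nat} => \prod_(i <- finsupp M) psum n i.+1 ^+ M i) f.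

(* m_l (x_0, ..., x_(n-1)): the sum of the monomials whose nonzero exponents are
   a rearrangement of [l]. *)
Definition msymn (n : nat) (l : intpart) : mpoly.mpoly n C :=
  \sum_(M : mpoly.bmultinom n (sumn l).+1 | perm_eq [seq e <- M | e != 0%N] l)
    mpoly.mpolyX C M.

(* Identities in the algebra of symmetric functions in infinitely many variables
   that involve m_l are stated in n variables, for all n. *)
Definition is_jack (a : C) (J : intpart -> poly_inf C) : Prop :=
  (forall l, exists (s : seq intpart) (c : intpart -> C),
     (forall u, u \in s -> dominates l u /\ u <> l) /\
     forall n, restr n (J l) = msymn n l + \sum_(u <- s) c u *: msymn n u) /\
  (forall l u, l <> u -> jack_form a (J l) (J u) = 0).

End Jack.

(* Main.v *)
(** Since a_n is a coefficient of the vertex operator, the words of length [k] in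
    a_0, ..., a_(p-1) applied to v_p are the coefficients of z^e, 0 <= e_j < p, in
    Delta(z)^(2m) * prod_(i, j) (1 - x_i z_j)^(-m).  The last product is the
    reproducing kernel of Jack's form, so the form pairs such a coefficient with [f]
    to the coefficient of z^e in Delta(z)^(2m) f(z_1, ..., z_k).

    Upper bound.  Let g_a be the coefficient of t^a in prod_j (1 - t z_j)^(-m).
    Divided differences put Delta^(2m) g_a in the ideal generated by the
    z_j^(a + (k-1)m).  Hence a word is orthogonal to every multiple of g_a with
    a > N = p - (k-1)m - 1; as the products of the g_a are dual to the m_mu, it is a
    combination of m_mu, or equivalently (triangularity) of J_mu, with mu_1 <= N.
    A J_mu with more than [k] rows vanishes at (z_1, ..., z_k), so it is orthogonal to
    all words and does not occur in them.

    Lower bound.  Let [f] be a combination of the J_mu with mu in the rectangle that is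
    orthogonal to all words, and D = Delta^m.  The constant term of
    |D(z) f(z)|^2 on the torus is a combination of coefficients of z^e in D^2 f with
    0 <= e_j < p, hence 0; so f(z_1, ..., z_k) = 0 and [f] = 0. *)

Require Import Defs.
From HB Require Import structures.
From mathcomp Require Import all_boot all_order all_algebra reals complex.
From mathcomp Require Import finmap ring zify.
From mathcomp.multinomials Require Import mpoly.
From mathcomp.multinomials Require Import monalg.
Import GRing.Theory Num.Theory.
Local Open Scope ring_scope.
Local Open Scope complex_scope.

Set Implicit Arguments.
Unset Strict Implicit.
Unset Printing Implicit Defensive.

(** * Exponentials of operator series *)

(** Under I, h_(-n) becomes c p_n and h_n becomes (n/c) d/dp_n, where 2 c^2 = m. The exponents of
    the vertex operator become m sum p_n z^n / n and -2 sum z^(-n) d/dp_n: the first produces G(z) =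
    sum g_d z^d, and the product 2m of the two constants is the exponent of Delta. Jack's form with
    coupling m makes m p_n adjoint to n d/dp_n, so pairing with products of the g_d reads off
    coefficients in finitely many variables.

    The two conditions cutting out the rectangle behave differently under dominance. A bound on the
    first part is inherited by all smaller partitions and can be imposed by triangular elimination;
    the number of rows can only grow on the way down, so it is imposed by orthogonality of the J_mu.

    No dimensions are counted. The matrix of pairings between words and the J_mu of the rectangle
    has full column rank; the dual system built from words lies in the span of the rectangle by the
    upper bound, hence consists of multiples of the J_mu. For k > 0 and N < 0 the same argument says
    that all words of length k vanish. *)

Section OperatorSeries.
Variables (K : numFieldType) (V : lmodType K).

Definition ser1 : nat -> V -> V := fun n v => if n == 0%N then v else 0.

Definition ser_mul (X Y : nat -> V -> V) : nat -> V -> V :=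
  fun n v => \sum_(i < n.+1) X i (Y (n - i)%N v).

Definition ser_exp (X : nat -> V -> V) : nat -> V -> V :=
  fun n v => \sum_(k < n.+1) (k`!%:R)^-1 *: iter k (ser_mul X) ser1 n v.

End OperatorSeries.

(** Carries the exponentials of the vertex operator from Fock space to symmetric functions; with X =
    Y it says that an operator commuting with all coefficients commutes with the exponential. *)
Lemma ser_exp_intertwine (K : numFieldType) (V W : lmodType K)
    (f : {linear V -> W}) (X : nat -> V -> V) (Y : nat -> W -> W) :
  (forall i v, Y i (f v) = f (X i v)) ->
  forall n v, ser_exp Y n (f v) = f (ser_exp X n v).
Proof.
move=> XY n v; rewrite /ser_exp linear_sum; apply: eq_bigr => k _.
rewrite linearZZ; congr (_ *: _); move: (nat_of_ord k) => j {k}; elim: j n v => [|j IH] n v /=.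
  by rewrite /ser1; case: eqP; rewrite ?raddf0.
by rewrite /ser_mul raddf_sum; apply: eq_bigr => i _; rewrite IH XY.
Qed.

Lemma exchange_triangle (V : nmodType) (F : nat -> nat -> V) n :
  \sum_(i < n.+1) \sum_(j < (n - i).+1) F i j =
  \sum_(j < n.+1) \sum_(i < (n - j).+1) F i j.
Proof.
have E (G : nat -> nat -> V) : \sum_(i < n.+1) \sum_(j < (n - i).+1) G i j =
    \sum_(i < n.+1) \sum_(j < n.+1 | (i + j < n.+1)%N) G i j.
  apply: eq_bigr => i _; rewrite (big_ord_widen n.+1 (G i)); last by lia.
  by apply: eq_bigl => j /=; have := ltn_ord i; lia.
rewrite E (E (fun j i => F i j)) (exchange_big_dep xpredT) //=.
by apply: eq_bigr => j _; apply: eq_bigl => i; rewrite addnC.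
Qed.

(** * Exponentials of commuting operators through their logarithmic derivative *)

Section ExpRecursion.
Variables (K : numFieldType) (V : lmodType K) (X : nat -> V -> V).
Hypothesis XL : forall i, linear (X i).
Hypothesis X0 : forall v, X 0 v = 0.
Hypothesis XC : forall i j v, X i (X j v) = X j (X i v).

Let P k := iter k (ser_mul X) (@ser1 K V).

HB.instance Definition _ i := GRing.isLinear.Build K V V *:%R (X i) (XL i).

Lemma ser_pow_lt k n v : (n < k)%N -> P k n v = 0.
Proof.
elim: k n => // k IH n nk; rewrite /P /= /ser_mul big1 // => -[[|i] /= ilt] _.
  by rewrite X0.
by rewrite -/(P k) IH ?raddf0 //; lia.
Qed.

Lemma ser_powE k n v : P k.+1 n v = \sum_(i < n.+1) X i (P k (n - i)%N v).
Proof. by []. Qed.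

(** Coefficient form of t d/dt X^(k+1) = (k+1) (t X') X^k; commutativity brings the differentiated
    factor to the front. *)
Lemma ser_pow_deriv k n v :
  P k.+1 n v *+ n = (\sum_(i < n.+1) X i (P k (n - i)%N v) *+ i) *+ k.+1.
Proof.
elim: k n => [|k IH] n.
  rewrite ser_powE mulr1n -sumrMnl; apply: eq_bigr => i _; rewrite /P /= /ser1 subn_eq0.
  case: leqP => ni; last by rewrite raddf0 !mul0rn.
  by congr (_ *+ _); have := ltn_ord i; lia.
rewrite ser_powE -sumrMnl.
have -> : \sum_(i < n.+1) X i (P k.+1 (n - i)%N v) *+ n =
   \sum_(i < n.+1) X i (P k.+1 (n - i)%N v) *+ i +
   \sum_(i < n.+1) X i (P k.+1 (n - i)%N v *+ (n - i)).
  rewrite -big_split; apply: eq_bigr => i _ /=.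
  by rewrite raddfMn -mulrnDr subnKC // -ltnS.
rewrite [RHS]mulrS; congr (_ + _).
under eq_bigr => i _ do rewrite IH raddfMn raddf_sum.
rewrite sumrMnl; congr (_ *+ _).
under eq_bigr => i _ do under eq_bigr => j _ do rewrite raddfMn /= -subnDA.
rewrite (exchange_triangle (fun i j => X i (X j (P k (n - (i + j)) v)) *+ j)).
apply: eq_bigr => j _; rewrite ser_powE raddf_sum -sumrMnl.
by apply: eq_bigr => i _; rewrite XC -subnDA addnC.
Qed.

Lemma ser_exp_wide N n v : (n <= N)%N ->
  ser_exp X n v = \sum_(k < N.+1) (k`!%:R)^-1 *: P k n v.
Proof.
move=> nN; rewrite /ser_exp.
rewrite (big_ord_widen N.+1 (fun k => (k`!%:R)^-1 *: P k n v)) // big_mkcond /=.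
apply: eq_bigr => k _; case: ltnP => // nk.
by rewrite ser_pow_lt ?scaler0.
Qed.

(** Coefficient form of t d/dt exp X = (t X') exp X. This recursion determines the coefficients of
    positive degree, and the later identities between exponentials are inductions on it. *)
Lemma ser_exp_rec n v :
  ser_exp X n v *+ n = \sum_(i < n.+1) X i (ser_exp X (n - i)%N v) *+ i.
Proof.
case: n => [|n]; first by rewrite mulr0n big_ord1 mulr0n.
rewrite /ser_exp -sumrMnl big_ord_recl [X in X + _]/= {1}/ser1 /= scaler0 mul0rn add0r.
under eq_bigr => k _.
  rewrite -[ser_mul _ _ _ _]/(P k.+1 n.+1 v) -[bump 0 k]/k.+1 scalerMnr ser_pow_deriv.
  rewrite -scalerMnr scalerMnl factS natrM invfM -mulr_natl mulrA divff ?pnatr_eq0 //.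
  rewrite mul1r scaler_sumr.
  over.
rewrite exchange_big; apply: eq_bigr => i _ /=.
have [->|i0] := posnP i.
  by rewrite mulr0n big1 // => k _; rewrite mulr0n scaler0.
rewrite -/(ser_exp X _ v) (@ser_exp_wide n); last by lia.
by rewrite linear_sum -sumrMnl; apply: eq_bigr => k _; rewrite linearZZ scalerMnr.
Qed.

End ExpRecursion.

(** * Symmetric functions and the polynomials g_d *)

(* The algebra of symmetric functions through what is used of it: [ps_var n] is
   p_(n+1), [ps_der n] the derivation d/dp_(n+1), [ps_ev k] the restriction to k
   variables and [ps_form] Jack's form with coupling [m]. *)
Record psum_algebra (C : numClosedFieldType) (m : nat) := PsumAlgebra {
  ps_alg :> comAlgType C;
  ps_var : nat -> ps_alg;
  ps_ind : forall P : ps_alg -> Prop, P 1 ->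
    (forall a f g, P f -> P g -> P (a *: f + g)) ->
    (forall n f, P f -> P (ps_var n * f)) -> forall f, P f;
  ps_der : nat -> ps_alg -> ps_alg;
  ps_der_linear : forall n, linear (ps_der n);
  ps_derM : forall n f g, ps_der n (f * g) = ps_der n f * g + f * ps_der n g;
  ps_der_var : forall n i, ps_der n (ps_var i) = (i == n)%:R;
  ps_ev : forall k, {lrmorphism ps_alg -> mpoly.mpoly k C};
  ps_ev_var : forall k i, ps_ev k (ps_var i) = psum C k i.+1;
  ps_form : ps_alg -> ps_alg -> C;
  ps_form_linear : forall h a f g, ps_form (a *: f + g) h = a * ps_form f h + ps_form g h;
  ps_form_sym : forall f g, ps_form f g = ps_form g f;
  ps_form_adj : forall n f g,
    m%:R * ps_form (ps_var n * f) g = n.+1%:R * ps_form f (ps_der n g);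
  ps_form1 : ps_form 1 1 = 1;
  ps_form_nondeg : forall g, (forall f, ps_form f g = 0) -> g = 0 }.

Section PsumAlgebra.
Variables (C : numClosedFieldType) (m : nat) (A : psum_algebra C m).
Local Notation L := (ps_alg A).
Local Notation pv := (ps_var A).
Local Notation dp := (@ps_der C m A).
Local Notation dpM := (@ps_derM C m A).
Local Notation dp_pv := (@ps_der_var C m A).

HB.instance Definition _ n := GRing.isLinear.Build C L L *:%R (dp n) (@ps_der_linear C m A n).

Lemma dp1 n : dp n 1 = 0.
Proof.
have /(congr1 (fun x => x - dp n 1)) := dpM n 1 1.
by rewrite !mulr1 mul1r addrK subrr.
Qed.

Lemma dpC i j f : dp i (dp j f) = dp j (dp i f).
Proof.
elim/(@ps_ind C m A): f => [|a f g Hf Hg|n f Hf]; first by rewrite !dp1 !linear0.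
  by rewrite !linearP /= Hf Hg.
rewrite !dpM !dp_pv !mulr_natl !linearD /= !linearMn !dpM !dp_pv !mulr_natl Hf.
by rewrite addrCA.
Qed.

(** [creL n] and [annL n] are what sqrt(2m) h_(-n) / n and - sqrt(2m) h_n / n become under I;
    [pv n'] is p_(n'+1), hence the shifted index. *)
Definition creL (n : nat) (f : L) : L :=
  if n is n'.+1 then (m%:R / n%:R) *: (pv n' * f) else 0.

Definition annL (n : nat) (f : L) : L :=
  if n is n'.+1 then (- 2%:R) *: dp n' f else 0.

Lemma creL_linear n : linear (creL n).
Proof.
case: n => [|n] a f g /=; first by rewrite scaler0 addr0.
by rewrite mulrDr scalerDr -scalerAr !scalerA mulrC.
Qed.

Lemma annL_linear n : linear (annL n).
Proof.
case: n => [|n] a f g /=; first by rewrite scaler0 addr0.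
by rewrite linearP /= scalerDr !scalerA mulrC.
Qed.

HB.instance Definition _ n := GRing.isLinear.Build C L L *:%R (creL n) (creL_linear n).
HB.instance Definition _ n := GRing.isLinear.Build C L L *:%R (annL n) (annL_linear n).

Lemma creLC i j f : creL i (creL j f) = creL j (creL i f).
Proof.
case: i j => [|i] [|j] //=; rewrite ?mulr0 ?scaler0 //.
by rewrite -!scalerAr !scalerA (mulrCA (pv i)); congr (_ *: _); rewrite mulrC.
Qed.

Lemma annLC i j f : annL i (annL j f) = annL j (annL i f).
Proof.
case: i j => [|i] [|j] //=; rewrite ?linear0 ?scaler0 //.
by rewrite !linearZZ /= dpC.
Qed.

Lemma annLM i f g : annL i (f * g) = annL i f * g + f * annL i g.
Proof.
case: i => [|i] /=; first by rewrite mul0r mulr0 addr0.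
by rewrite dpM scalerDr -scalerAl -scalerAr.
Qed.

(* The coefficient of t^d in exp (m sum_n p_n t^n / n) = prod_i (1 - x_i t)^(-m). *)
Definition gpol (d : nat) : L := ser_exp creL d 1.
(* g_(d - c), which is 0 for c > d. *)
Definition gs (d c : nat) : L := if (c <= d)%N then gpol (d - c) else 0.
(* The coefficient of t^s in exp (- 2 sum_n t^n d/dp_n). *)
Definition Eop (s : nat) : L -> L := ser_exp annL s.

Lemma ser_exp_cre d f : ser_exp creL d f = gpol d * f.
Proof.
rewrite -[in LHS](mul1r f).
(* Multiplication by [f] commutes with the multiplication operators [creL], so [f] can be pulled out
   of the exponential. *)
pose F : L -> L := fun u => u * f.
have FL : linear F by move=> a u v; rewrite /F mulrDl scalerAl.
pose F' : {linear L -> L} := HB.pack F (GRing.isLinear.Build C L L *:%R F FL).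
apply: (@ser_exp_intertwine _ _ _ F') => i v /=; rewrite /F.
by case: i => [|i] /=; rewrite ?mul0r // -scalerAl mulrA.
Qed.

Lemma Eop_linear s : linear (Eop s).
Proof.
move=> a f g; rewrite /Eop /ser_exp scaler_sumr -big_split; apply: eq_bigr => k _ /=.
rewrite !scalerA [a * _]mulrC -scalerA -scalerDr; congr (_ *: _).
move: (nat_of_ord k) => j {k}; elim: j s => [|j IH] s /=.
  by rewrite /ser1; case: ifP => // _; rewrite scaler0 addr0.
rewrite /ser_mul scaler_sumr -big_split; apply: eq_bigr => i _ /=.
by rewrite IH linearP.
Qed.
HB.instance Definition _ s := GRing.isLinear.Build C L L *:%R (Eop s) (Eop_linear s).

Lemma mulrnI_lam (n : nat) (f g : L) : f *+ n.+1 = g *+ n.+1 -> f = g.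
Proof.
rewrite -!scaler_nat => /(congr1 (fun x => (n.+1%:R)^-1 *: x)).
by rewrite !scalerA mulVf ?pnatr_eq0 // !scale1r.
Qed.

Lemma gpol0 : gpol 0 = 1.
Proof. by rewrite /gpol /ser_exp big_ord1 fact0 invr1 scale1r. Qed.

Lemma Eop0 f : Eop 0 f = f.
Proof. by rewrite /Eop /ser_exp big_ord1 fact0 invr1 scale1r. Qed.

Lemma gpol_rec d : gpol d *+ d = \sum_(i < d) m%:R *: (pv i * gpol (d.-1 - i)).
Proof.
rewrite /gpol (ser_exp_rec creL_linear) //; last exact: creLC.
rewrite big_ord_recl mulr0n add0r; apply: eq_bigr => i _ /=.
rewrite -scaler_nat scalerA mulrCA divff ?pnatr_eq0 // mulr1.
by congr (_ *: (_ * ser_exp _ _ _)); rewrite /bump /=; lia.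
Qed.

Lemma Eop_rec s f : Eop s f *+ s = \sum_(i < s.+1) annL i (Eop (s - i) f) *+ i.
Proof. by rewrite /Eop (ser_exp_rec annL_linear) //; exact: annLC. Qed.

Lemma gs_rec d c :
  gs d c *+ (d - c) = \sum_(i < d) m%:R *: (pv i * gs (d.-1 - i) c).
Proof.
rewrite /gs; case: leqP => cd; last first.
  rewrite mul0rn big1 // => i _; have := ltn_ord i => id.
  by case: leqP; [lia | rewrite mulr0 scaler0].
rewrite gpol_rec (big_ord_widen d (fun i => m%:R *: (pv i * gpol ((d - c).-1 - i)))); last by lia.
rewrite big_mkcond; apply: eq_bigr => i _; have := ltn_ord i => id.
case: ltnP => H; last by case: leqP; [lia | rewrite mulr0 scaler0].
case: leqP => H'; last by lia.
by congr (_ *: (_ * gpol _)); lia.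
Qed.

(** Coefficient form of (n+1) d/dp_(n+1) G(t) = m t^(n+1) G(t). *)
Lemma dp_gs0 n d : dp n (gpol d) *+ n.+1 = m%:R *: gs d n.+1.
Proof.
have [b] := ubnP d; elim: b d => // b IH [|d] db.
  by rewrite gpol0 dp1 mul0rn /gs scaler0.
apply: (@mulrnI_lam d); rewrite mulrnAC -linearMn gpol_rec linear_sum.
under eq_bigr => i _ do rewrite linearZZ /= dpM dp_pv scalerDr.
rewrite big_split /= mulrnDl -sumrMnl -[X in _ + X]sumrMnl.
have -> : \sum_(i < d.+1) m%:R *: (pv i * dp n (gpol (d - i))) *+ n.+1 =
          m%:R *: (gs d.+1 n.+1 *+ (d - n)).
  rewrite -subSS gs_rec scaler_sumr; apply: eq_bigr => i _.
  rewrite scalerMnr -mulrnAr IH; last by have := ltn_ord i; lia.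
  by rewrite -!scalerAr.
have -> : \sum_(i < d.+1) m%:R *: ((i == n :> nat)%:R * gpol (d - i)) *+ n.+1 =
          m%:R *: (gs d.+1 n.+1 *+ n.+1).
  rewrite /gs ltnS subSS; case: leqP => nd; last first.
    rewrite mul0rn scaler0 big1 // => i _; have := ltn_ord i => id.
    by case: eqP => [e|_]; [lia | rewrite mul0r scaler0 mul0rn].
  have nd' : (n < d.+1)%N by [].
  rewrite (bigD1 (Ordinal nd')) //= eqxx mul1r big1 ?addr0 ?scalerMnr // => i ni.
  have /negPf -> : (i != n :> nat) by apply: contra ni => /eqP e; apply/eqP/val_inj.
  by rewrite mul0r scaler0 mul0rn.
rewrite -scalerDr -mulrnDr scalerMnr.
rewrite /gs ltnS; case: leqP => nd; last by rewrite !mul0rn scaler0.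
by congr (_ *: (_ *+ _)); lia.
Qed.

Lemma dp_gs n d c : dp n (gs d c) *+ n.+1 = m%:R *: gs d (c + n.+1).
Proof.
rewrite {1}/gs; case: leqP => cd; last first.
  by rewrite linear0 mul0rn /gs; case: leqP; [lia | rewrite scaler0].
rewrite dp_gs0 /gs; congr (_ *: _); case: leqP => H; case: leqP => H' //; try lia.
by congr gpol; lia.
Qed.

(** The exponential of a derivation is multiplicative: both sides satisfy the recursion [Eop_rec] in
    s. *)
Lemma EopM s f g : Eop s (f * g) = \sum_(a < s.+1) Eop a f * Eop (s - a) g.
Proof.
have [b] := ubnP s; elim: b s => // b IH [|s] sb; first by rewrite big_ord1 !Eop0.
apply: (@mulrnI_lam s); rewrite Eop_rec.
have -> : \sum_(i < s.+2) annL i (Eop (s.+1 - i) (f * g)) *+ i =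
  \sum_(i < s.+2) \sum_(a < (s.+1 - i).+1)
    (annL i (Eop a f) * Eop (s.+1 - i - a) g + Eop a f * annL i (Eop (s.+1 - i - a) g)) *+ i.
  apply: eq_bigr => i _; have [->|i0] := posnP i.
    by rewrite mulr0n big1 // => a _; rewrite mulr0n.
  rewrite IH; last by lia.
  by rewrite linear_sum -sumrMnl; apply: eq_bigr => a _; rewrite [X in X *+ _]annLM.
under eq_bigr => i _ do under eq_bigr => a _ do rewrite mulrnDl.
under eq_bigr => i _ do rewrite big_split /=.
rewrite big_split /=.
have -> : \sum_(i < s.+2) \sum_(a < (s.+1 - i).+1)
    (annL i (Eop a f) * Eop (s.+1 - i - a) g) *+ i =
  \sum_(a < s.+2) Eop a f * Eop (s.+1 - a) g *+ a.
  under eq_bigr => i _.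
    rewrite (reindex_inj rev_ord_inj) /=.
    under eq_bigr => a _.
      have -> : ((s.+1 - i).+1 - a.+1 = s.+1 - (i + a))%N by lia.
      have -> : (s.+1 - i - (s.+1 - (i + a)) = a)%N by have := ltn_ord a; lia.
    over.
  over.
  rewrite (exchange_triangle (fun i a => annL i (Eop (s.+1 - (i + a)) f) * Eop a g *+ i)).
  rewrite [RHS](reindex_inj rev_ord_inj); apply: eq_bigr => a _ /=.
  have -> : (s.+2 - a.+1 = s.+1 - a)%N by lia.
  have -> : (s.+1 - (s.+1 - a) = a)%N by have := ltn_ord a; lia.
  rewrite -mulrnAl Eop_rec mulr_suml; apply: eq_bigr => i _.
  by rewrite mulrnAl; congr (annL i (Eop _ f) * _ *+ _); lia.
rewrite (exchange_triangle (fun i a => Eop a f * annL i (Eop (s.+1 - i - a) g) *+ i)).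
rewrite -big_split -sumrMnl; apply: eq_bigr => a _ /=.
have -> : \sum_(i < (s.+1 - a).+1) Eop a f * annL i (Eop (s.+1 - i - a) g) *+ i =
   Eop a f * Eop (s.+1 - a) g *+ (s.+1 - a).
  rewrite -mulrnAr Eop_rec mulr_sumr; apply: eq_bigr => i _.
  by rewrite -mulrnAr; congr (_ * (annL i (Eop _ g) *+ _)); lia.
by rewrite -mulrnDr subnKC //; have := ltn_ord a.
Qed.

(** Compares coefficients of t^s in t d/dt (1 - t)^n = - n t (1 - t)^n / (1 - t). *)
Lemma alt_bin_sum (n s : nat) :
  \sum_(j < s) (-1) ^+ j * 'C(n, j)%:R * (- n%:R) = s%:R * ((-1) ^+ s * 'C(n, s)%:R) :> C.
Proof.
elim: s => [|s IH]; first by rewrite big_ord0 mul0r.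
rewrite big_ord_recr IH /= [RHS]mulrCA -natrM mul_bin_left exprS.
have [sn|ns] := leqP s n; last by rewrite bin_small // muln0 !mulr0 mul0r addr0.
by rewrite natrM natrB //; ring.
Qed.

(** By [dp_gs], exp(-2 sum t^n d/dp_n) multiplies G(z) by exp(-2m sum (t z)^n / n) = (1 - t z)^(2m);
    a factor z^s lowers the index of g by s. *)
Lemma Eop_gs s d c :
  Eop s (gs d c) = ((-1) ^+ s * 'C(2 * m, s)%:R) *: gs d (c + s).
Proof.
have [b] := ubnP s; elim: b s => // b IH [|s] sb.
  by rewrite Eop0 bin0 mulr1 scale1r addn0.
apply: (@mulrnI_lam s); rewrite Eop_rec big_ord_recl mulr0n add0r.
under eq_bigr => i _.
  rewrite /= subSS IH; last by lia.
  rewrite linearZZ -[bump 0 i]/i.+1 scalerA scalerMnr dp_gs !scalerA.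
  have -> : (c + (s - i) + i.+1 = c + s.+1)%N by have := ltn_ord i; lia.
over.
rewrite -scaler_suml scalerMnl; congr (_ *: _).
rewrite (reindex_inj rev_ord_inj) /=.
under eq_bigr => i _.
  have -> : (s - (s.+1 - i.+1) = i)%N by have := ltn_ord i; lia.
over.
rewrite -[RHS]mulr_natl -alt_bin_sum; apply: eq_bigr => i _.
by rewrite natrM; ring.
Qed.

Lemma annL_Eop i s f : annL i (Eop s f) = Eop s (annL i f).
Proof.
by rewrite /Eop (@ser_exp_intertwine _ _ _ (annL i) annL annL) // => j v; rewrite annLC.
Qed.

Lemma Eop1 s : (0 < s)%N -> Eop s 1 = 0.
Proof.
case: s => // s _; apply: (@mulrnI_lam s); rewrite Eop_rec mul0rn big1 // => -[[|i] ilt] _.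
  by rewrite mulr0n.
by rewrite annL_Eop /= dp1 scaler0 linear0 mul0rn.
Qed.

Lemma Eop_pv s n : (n.+1 < s)%N -> Eop s (pv n) = 0.
Proof.
case: s => // s ns; apply: (@mulrnI_lam s); rewrite Eop_rec mul0rn big1 // => -[[|i] ilt] _.
  by rewrite mulr0n.
rewrite annL_Eop /= dp_pv; case: eqP => [<-|_]; last by rewrite scaler0 linear0 mul0rn.
by rewrite linearZZ /= Eop1 ?scaler0 ?mul0rn //; lia.
Qed.

(** E_s lowers the weight by s when p_(n+1) has weight n+1; this bounds the number of nonzero terms
    of a mode. *)
Lemma Eop_pvM n f w : (forall s, (w < s)%N -> Eop s f = 0) ->
  forall s, (n.+1 + w < s)%N -> Eop s (pv n * f) = 0.
Proof.
move=> H s ws; rewrite EopM big1 // => a _; have [na|an] := ltnP n.+1 a.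
  by rewrite Eop_pv ?mul0r.
by rewrite H ?mulr0 //; lia.
Qed.

End PsumAlgebra.

(** * Words as coefficients *)

Section LinearExtension.
Variables (C : comNzRingType) (k : nat) (V : lmodType C) (h : mpoly.multinom k -> V).

Definition mplin (F : mpoly.mpoly k C) : V :=
  \sum_(c <- mpoly.msupp F) mpoly.mcoeff c F *: h c.

Lemma mplinEw (s : seq (mpoly.multinom k)) (F : mpoly.mpoly k C) :
  uniq s -> {subset mpoly.msupp F <= s} ->
  mplin F = \sum_(c <- s) mpoly.mcoeff c F *: h c.
Proof.
move=> us sub; rewrite [RHS](bigID (mem (mpoly.msupp F))) /=.
rewrite [X in _ = _ + X]big1 ?addr0 => [|c]; last first.
  by rewrite -mpoly.mcoeff_eq0 => /eqP ->; rewrite scale0r.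
rewrite -[RHS]big_filter; apply: perm_big; apply: uniq_perm.
- exact: mpoly.msupp_uniq.
- exact: filter_uniq.
- by move=> c; rewrite mem_filter; apply/idP/andP => [cF|[] //]; split=> //; apply: sub.
Qed.

Lemma mplin_is_linear : linear mplin.
Proof.
move=> a F G.
pose s := undup (mpoly.msupp F ++ mpoly.msupp G ++ mpoly.msupp (a *: F + G)).
have us : uniq s by exact: undup_uniq.
rewrite !(@mplinEw s) //; try by move=> c cF; rewrite mem_undup !mem_cat cF ?orbT.
rewrite scaler_sumr -big_split; apply: eq_bigr => c _ /=.
by rewrite mpoly.mcoeffD mpoly.mcoeffZ scalerDl scalerA.
Qed.
HB.instance Definition _ := GRing.isLinear.Build C (mpoly.mpoly k C) V *:%R mplin
  mplin_is_linear.

Lemma mplinX c : mplin (mpoly.mpolyX C c) = h c.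
Proof. by rewrite /mplin mpoly.msuppX big_seq1 mpoly.mcoeffX eqxx scale1r. Qed.

End LinearExtension.

Lemma mpoly_lin_ind (C : nzRingType) k (P : mpoly.mpoly k C -> Prop) :
  P 0 -> (forall c, P (mpoly.mpolyX C c)) ->
  (forall a F G, P F -> P G -> P (a *: F + G)) -> forall F, P F.
Proof. by move=> P0 PX PL F; elim/mpoly.mpolyind: F => // a c F _ _; apply: PL. Qed.

(** * Polynomials given by their reciprocal roots *)

Section ReciprocalRoots.
Variable R : comNzRingType.

Lemma coef_1subX_exp (x : R) n s :
  ((1 - x *: 'X) ^+ n)`_s = (-1) ^+ s * 'C(n, s)%:R * x ^+ s.
Proof.
elim: n s => [|n IH] s.
  by rewrite expr0 coef1; case: s => [|s]; rewrite ?bin0 ?mulr1 ?expr0 ?mulr1 // bin0n mulr0 mul0r.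
rewrite exprS mulrBl mul1r -scalerAl coefB coefZ coefXM.
case: s => [|s] /=; first by rewrite IH !bin0 mulr0 subr0.
by rewrite !IH binS natrD !exprS; ring.
Qed.

(** The reversal y^n P(1/y) of P(t) = prod (1 - x t). The size bound is proved along with it because
    the induction needs the coefficient of degree n+1 to vanish. *)
Lemma prod_1subX_homogenize (s : seq R) (y : R) :
  let P := \prod_(x <- s) (1 - x *: 'X) in
  (size P <= (size s).+1)%N /\
  \sum_(i < (size s).+1) P`_i * y ^+ (size s - i) = \prod_(x <- s) (y - x).
Proof.
elim: s => [|x s [IHs IH]] /=.
  by rewrite !big_nil size_poly1 big_ord1 coef1 expr0 mulr1.
rewrite !big_cons; set P := \prod_(x <- s) (1 - x *: 'X) in IHs IH *.
have HC i : ((1 - x *: 'X) * P)`_i = P`_i - x * (if i == 0%N then 0 else P`_i.-1).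
  by rewrite mulrBl mul1r -scalerAl coefB coefZ coefXM.
split.
  apply/leq_sizeP => j sj; rewrite HC !nth_default ?if_same ?mulr0 ?subr0 //.
    by apply: leq_trans IHs _; lia.
  by apply: leq_trans IHs _; lia.
under eq_bigr => i _ do rewrite HC mulrBl.
rewrite sumrB [RHS]mulrBl; congr (_ - _); last first.
  rewrite big_ord_recl /= mulr0 mul0r add0r -IH mulr_sumr; apply: eq_bigr => i _.
  by rewrite /bump /= add1n /= subSS mulrA.
rewrite big_ord_recr /= nth_default // mul0r addr0 -IH mulr_sumr.
apply: eq_bigr => i _; rewrite mulrCA -exprS; congr (_ * _ ^+ _).
by have := ltn_ord i; lia.
Qed.

End ReciprocalRoots.

Lemma signed_nat_scale (R : comNzRingType) (V : algType R) t n (v : V) :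
  ((-1) ^+ t * n%:R) *: v = (-1) ^+ t * n%:R * v.
Proof.
rewrite -scalerA scaler_nat -mulrA mulr_natl -signr_odd -[in RHS]signr_odd.
by case: odd; rewrite ?expr1 ?expr0 ?scaleN1r ?mulN1r ?scale1r ?mul1r.
Qed.

Section Words.
Variables (C : numClosedFieldType) (m : nat) (A : psum_algebra C m).
Local Notation L := (ps_alg A).
Local Notation gpol := (gpol A).
Local Notation gs := (gs A).
Local Notation Eop := (@Eop C m A).
Local Notation MP k := (mpoly.mpoly k C).
Local Notation mwiden := (@mpoly.mwiden _ _).
Local Notation x_ i := (mpoly.mpolyX C (mpoly.mnm1 i)).

(* The coefficient of z^e in F(z) prod_l G(z_l), where G(t) = sum_d g_d t^d. *)
Definition Phi (k : nat) (e : nat -> nat) : MP k -> L :=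
  mplin (fun c => \prod_(l < k) gs (e l) (c l)).
HB.instance Definition _ k e := GRing.Linear.on (@Phi k e).

Lemma PhiX k e c : Phi e (mpoly.mpolyX C c) = \prod_(l < k) gs (e l) (c l).
Proof. exact: mplinX. Qed.

Lemma Phi_widen k e (F : MP k) b :
  Phi e (mwiden F * x_ ord_max ^+ b) = Phi e F * gs (e k) b.
Proof.
elim/mpoly_lin_ind: F => [|c|a F G HF HG].
- by rewrite mpoly.mwiden0 mul0r !linear0 mul0r.
- rewrite mpoly.mwidenX mpoly.mpolyXn -mpoly.mpolyXD !PhiX big_ord_recr /=.
  congr (_ * gs _ _).
    apply: eq_bigr => l _; congr (gs _ _).
    rewrite mpoly.mnmDE mpoly.mnmwiden_widen mpoly.mulmnE mpoly.mnm1E.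
    case: eqP => [/(congr1 val) /= e1|_]; last by rewrite addn0.
    by have := ltn_ord l; rewrite -e1 ltnn.
  by rewrite mpoly.mnmDE mpoly.mnmwiden_ordmax mpoly.mulmnE mpoly.mnm1E eqxx mul1n.
- rewrite mpoly.mwidenD mpoly.mwidenZ mulrDl -scalerAl !linearP /= HF HG.
  by rewrite mulrDl -scalerAl.
Qed.

Lemma mpolyX_widen k (c : mpoly.multinom k.+1) :
  mpoly.mpolyX C c =
  mwiden (mpoly.mpolyX C [multinom c (widen_ord (leqnSn k) l) | l < k]) *
  x_ ord_max ^+ c ord_max.
Proof.
rewrite mpoly.mwidenX mpoly.mpolyXn -mpoly.mpolyXD; congr (mpoly.mpolyX C _).
apply/mpoly.mnmP => i; rewrite mpoly.mnmDE mpoly.mulmnE mpoly.mnm1E.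
case: (unliftP ord_max i) => [j|] ->; last first.
  by rewrite mpoly.mnmwiden_ordmax eqxx mul1n.
have -> : lift ord_max j = widen_ord (leqnSn k) j by apply/val_inj; rewrite /= /bump leqNgt ltn_ord.
rewrite mpoly.mnmwiden_widen mpoly.mnmE; case: eqP => [/(congr1 val) /= e1|_]; last by rewrite addn0.
by have := ltn_ord j; rewrite -e1 ltnn.
Qed.

(** The factor by which exp(-2 sum t^n d/dp_n) multiplies prod_l G(z_l), as a polynomial in t. *)
Definition annpol k : {poly MP k} := \prod_(l < k) (1 - x_ l *: 'X) ^+ (2 * m).

Lemma annpolS k : annpol k.+1 = map_poly mwiden (annpol k) * (1 - x_ ord_max *: 'X) ^+ (2 * m).
Proof.
rewrite /annpol big_ord_recr rmorph_prod; congr (_ * _); apply: eq_bigr => l _.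
rewrite rmorphXn rmorphB rmorph1 /= map_polyZ map_polyX /=.
by rewrite mpoly.mwidenX mpoly.mnmwiden1.
Qed.

Lemma Eop_Phi s k e (F : MP k) : Eop s (Phi e F) = Phi e (F * (annpol k)`_s).
Proof.
elim: k s F => [|k IH] s F.
  elim/mpoly_lin_ind: F => [|c|a F G HF HG].
  - by rewrite mul0r !linear0.
  - rewrite /annpol big_ord0 coef1 PhiX big_ord0.
    have -> : Eop s 1 = Eop s (gs 0 0) by rewrite /gs subnn gpol0.
    rewrite Eop_gs; case: s => [|s]; last by rewrite mulr0 !linear0.
    by rewrite mulr1 PhiX big_ord0 bin0 mulr1 scale1r /gs subnn gpol0.
  - by rewrite !linearP /= HF HG mulrDl -scalerAl linearP.
elim/mpoly_lin_ind: F => [|c|a F G HF HG].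
- by rewrite mul0r !linear0.
- rewrite mpolyX_widen Phi_widen EopM annpolS coefM mulr_sumr linear_sum.
  apply: eq_bigr => a _ /=; rewrite IH Eop_gs coef_map coef_1subX_exp /=.
  rewrite mulrACA -mpoly.mwidenM -signed_nat_scale -!scalerAr linearZZ /= -exprD.
  by rewrite Phi_widen.
- by rewrite !linearP /= HF HG mulrDl -scalerAl linearP.
Qed.

Definition vdm2 k : MP k :=
  \prod_(i < k) \prod_(j < k | (j < i)%N) (x_ i - x_ j) ^+ (2 * m).

Lemma vdm2S k : vdm2 k.+1 = mwiden (vdm2 k) *
   \prod_(l < k) (x_ ord_max - mwiden (x_ l)) ^+ (2 * m).
Proof.
rewrite /vdm2 big_ord_recr rmorph_prod; congr (_ * _).
  apply: eq_bigr => i _; rewrite big_mkcond big_ord_recr /=.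
  have -> : (k < i)%N = false by have := ltn_ord i; lia.
  rewrite mulr1 -big_mkcond rmorph_prod; apply: eq_bigr => j _.
  by rewrite rmorphXn rmorphB /= !mpoly.mwidenX !mpoly.mnmwiden1.
rewrite big_mkcond big_ord_recr /= ltnn mulr1; apply: eq_bigr => l _.
by rewrite ltn_ord mpoly.mwidenX mpoly.mnmwiden1.
Qed.

(* The mode a_(p - 1 - e) in charge - p + 2mk, transported to symmetric functions. *)
Definition lam_mode (k e : nat) (u : L) : L :=
  \sum_(s < (2 * m * k).+1) gs e (2 * m * k - s) * Eop s u.

Fixpoint lam_word (e : nat -> nat) (k : nat) : L :=
  if k is k'.+1 then lam_mode k' (e k') (lam_word e k') else 1.

Lemma annpol_homogenize k :
  \sum_(s < (2 * m * k).+1) mwiden ((annpol k)`_s) * x_ ord_max ^+ (2 * m * k - s) =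
  \prod_(l < k) (x_ ord_max - mwiden (x_ l)) ^+ (2 * m).
Proof.
(* Each variable is listed 2m times, so that the powers become products of linear factors. *)
pose xs := flatten [seq nseq (2 * m) (mwiden (x_ l)) | l <- enum 'I_k].
have szx : size xs = (2 * m * k)%N.
  rewrite size_flatten /shape -map_comp (eq_map (g := fun=> 2 * m)%N).
    by rewrite sumnE big_map big_enum sum_nat_const card_ord mulnC.
  by move=> l /=; rewrite size_nseq.
have prodx (T : comNzRingType) (f : MP k.+1 -> T) :
    \prod_(x <- xs) f x = \prod_(l < k) f (mwiden (x_ l)) ^+ (2 * m).
  rewrite big_flatten big_map big_enum /=; apply: eq_bigr => l _.
  by rewrite big_nseq iter_mulr_1.
rewrite -(prodx _ (fun x => x_ ord_max - x)).
have [_ <-] := prod_1subX_homogenize xs (x_ ord_max).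
rewrite szx; apply: eq_bigr => s _; congr (_ * _).
rewrite prodx -coef_map /=; congr (_ `_ s).
rewrite /annpol rmorph_prod /=.
under eq_bigr => l _ do rewrite rmorphXn rmorphB rmorph1 /= map_polyZ map_polyX /=.
by [].
Qed.

(** A new mode contributes the sum over s of z_k^(2mk - s) times the coefficient of t^s in prod_l (1
    - z_l t)^(2m). By homogenization this is prod_l (z_k - z_l)^(2m), the next row of Delta^(2m). *)
Lemma lam_wordE e k : lam_word e k = Phi e (vdm2 k).
Proof.
elim: k => [|k IH] /=.
  by rewrite /vdm2 big_ord0 -mpoly.mpolyX0 PhiX big_ord0.
rewrite vdm2S -annpol_homogenize mulr_sumr linear_sum /lam_mode.
apply: eq_bigr => s _ /=; rewrite IH Eop_Phi mulrA -mpoly.mwidenM Phi_widen.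
by rewrite mulrC.
Qed.

Lemma size_annpol k : (size (annpol k) <= (2 * m * k).+1)%N.
Proof.
elim: k => [|k IH]; first by rewrite /annpol big_ord0 size_poly1.
rewrite annpolS; apply/leq_sizeP => j kj; rewrite coefM big1 // => i _.
rewrite coef_map coef_1subX_exp /=; have [ik|ki] := leqP (size (annpol k)) i.
  by rewrite nth_default // mpoly.mwiden0 mul0r.
rewrite bin_small ?mulr0 ?mul0r ?mulr0 //.
by move: kj; rewrite mulnS; lia.
Qed.

(** Shows that [lam_mode], applied to a word of length k, leaves out only zero terms; within its
    range the subtraction 2mk - s is not truncated. *)
Lemma Eop_lam_word s e k : (2 * m * k < s)%N -> Eop s (lam_word e k) = 0.
Proof.
move=> ks; rewrite lam_wordE Eop_Phi nth_default ?mulr0 ?linear0 //.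
exact: leq_trans (size_annpol k) ks.
Qed.

Lemma eq_lam_word e e' k : (forall l, (l < k)%N -> e l = e' l) -> lam_word e k = lam_word e' k.
Proof.
elim: k => //= k IH ee'; rewrite ee' // IH // => l lk; apply: ee'; exact: ltnW.
Qed.

End Words.

(** * The reproducing property *)

Section Reproducing.
Variables (C : numClosedFieldType) (m : nat) (A : psum_algebra C m).
Hypothesis m_gt0 : (0 < m)%N.
Local Notation L := (ps_alg A).
Local Notation dp := (@ps_der C m A).
Local Notation form := (@ps_form C m A).
Local Notation ev := (@ps_ev C m A).
Local Notation gpol := (gpol A).
Local Notation gs := (gs A).
Local Notation MP k := (mpoly.mpoly k C).

Let m_neq0 : m%:R != 0 :> C.
Proof. by rewrite pnatr_eq0 -lt0n. Qed.

Definition formr (h f : L) : C := form f h.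
Lemma formr_is_linear h : linear_for *%R (formr h).
Proof. by move=> a f g; exact: ps_form_linear. Qed.
HB.instance Definition _ h := GRing.isLinear.Build C L C *%R (formr h) (formr_is_linear h).

Lemma form0l h : form 0 h = 0. Proof. exact: (linear0 (formr h)). Qed.
Lemma formZl a f h : form (a *: f) h = a * form f h.
Proof. exact: (linearZ_LR (formr h)). Qed.
Lemma formDl f g h : form (f + g) h = form f h + form g h.
Proof. exact: (linearD (formr h)). Qed.
Lemma formBl f g h : form (f - g) h = form f h - form g h.
Proof. exact: (linearB (formr h)). Qed.
Lemma formMnl f n h : form (f *+ n) h = form f h *+ n.
Proof. exact: (linearMn (formr h)). Qed.
Lemma form_suml (I : Type) (r : seq I) (P : pred I) (F : I -> L) h :
  form (\sum_(i <- r | P i) F i) h = \sum_(i <- r | P i) form (F i) h.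
Proof. exact: (linear_sum (formr h)). Qed.

Lemma der_prod (I : eqType) (r : seq I) (F : I -> L) n : uniq r ->
  dp n (\prod_(l <- r) F l) =
  \sum_(l <- r) dp n (F l) * \prod_(l' <- r | l' != l) F l'.
Proof.
elim: r => [|x r IH] /=; first by rewrite !big_nil dp1.
move=> /andP[xr ur]; rewrite big_cons ps_derM IH // big_cons; congr (_ + _).
  rewrite big_cons eqxx /= [in RHS]big_seq_cond [in LHS]big_seq.
  congr (_ * _); apply: eq_bigl => l; case lr: (l \in r) => //=.
  by apply/esym; apply: contraNneq xr => <-.
rewrite mulr_sumr [LHS]big_seq [RHS]big_seq; apply: eq_bigr => l lr.
rewrite big_cons; have -> : x != l by apply: contraNneq xr => ->.
by rewrite mulrCA.
Qed.

Lemma form_gpol_mul1 d f : (0 < d)%N -> form (gpol d * f) 1 = 0.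
Proof.
move=> d0; have : form ((gpol d *+ d) * f) 1 = 0.
  rewrite gpol_rec mulr_suml form_suml big1 // => i _.
  by rewrite -scalerAl formZl -mulrA ps_form_adj dp1 ps_form_sym form0l mulr0.
by rewrite mulrnAl formMnl => /eqP; rewrite mulrn_eq0 gtn_eqF //= => /eqP.
Qed.

Lemma mcoeffMX_sub k (F : MP k) (c d : mpoly.multinom k) :
  mpoly.mcoeff d (F * mpoly.mpolyX C c) =
  if [forall l, (c l <= d l)%N] then mpoly.mcoeff [multinom (d l - c l)%N | l < k] F else 0.
Proof.
case: ifP => [/forallP cd|/negP cd].
  have -> : d = mpoly.mnm_add c [multinom (d l - c l)%N | l < k].
    by apply/mpoly.mnmP => l; rewrite mpoly.mnmDE mpoly.mnmE subnKC.
  rewrite mpoly.mcoeffMX; congr (mpoly.mcoeff _ F); apply/mpoly.mnmP => l.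
  by rewrite !mpoly.mnmE addKn.
apply/eqP; rewrite mpoly.mcoeff_eq0 (perm_mem (mpoly.msuppMX _ _)).
apply/negP => /mapP[c' _ dE]; apply: cd; apply/forallP => l.
by rewrite dE mpoly.mnmDE leq_addr.
Qed.

(** Induction on [h]: multiplication by p_n is adjoint to (n/m) d/dp_n, which lowers one index of
    prod g_(d_l) by n, while p_n = sum x_l^n raises one exponent of a monomial by n. *)
Theorem form_gpol k (d : mpoly.multinom k) h :
  form (\prod_(l < k) gpol (d l)) h = mpoly.mcoeff d (ev k h).
Proof.
elim/(@ps_ind C m A): h d => [|a f g Hf Hg|n f IH] d.
- rewrite rmorph1 mpoly.mcoeff1; case: (boolP [exists l, (0 < d l)%N]) => [/existsP[l dl]|].
    rewrite (bigD1 l) //= form_gpol_mul1 //.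
    by case: eqP dl => // ->; rewrite mpoly.mnm0E.
  rewrite negb_exists => /forallP d0.
  have -> : d = mpoly.mnm0 by apply/mpoly.mnmP => l; rewrite mpoly.mnm0E; have := d0 l; lia.
  rewrite eqxx big1 ?ps_form1 // => l _.
  by rewrite mpoly.mnm0E gpol0.
- by rewrite ps_form_sym ps_form_linear linearP mpoly.mcoeffD mpoly.mcoeffZ !(ps_form_sym _ (\prod__ _)) Hf Hg.
apply: (mulfI m_neq0).
rewrite ps_form_sym ps_form_adj ps_form_sym mulr_natl -formMnl.
rewrite der_prod ?index_enum_uniq // -sumrMnl form_suml rmorphM /= ps_ev_var /psum.
rewrite mulr_suml raddf_sum mulr_sumr; apply: eq_bigr => l _ /=.
rewrite -mulrnAl dp_gs0 -scalerAl formZl; congr (_ * _).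
rewrite mpoly.mpolyXn [_ * ev k f]mulrC mcoeffMX_sub /gs.
have leE : [forall l', (mpoly.mnm_muln (mpoly.mnm1 l) n.+1 l' <= d l')%N] = (n < d l)%N.
  apply/forallP/idP => [/(_ l)|nd l']; rewrite mpoly.mulmnE mpoly.mnm1E ?eqxx ?mul1n //.
  by case: eqP => [<-|_]; rewrite ?mul1n.
rewrite leE; case: ifP => nd; last by rewrite mul0r form0l.
rewrite -IH [in RHS](bigD1 l) //= mpoly.mnmE mpoly.mulmnE mpoly.mnm1E eqxx mul1n.
congr (form (_ * _) _); apply: eq_bigr => l' ll'; rewrite mpoly.mnmE.
by rewrite mpoly.mulmnE mpoly.mnm1E eq_sym (negPf ll') subn0.
Qed.

Lemma form_Phi k (e : nat -> nat) (F : MP k) h :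
  form (Phi A e F) h = mpoly.mcoeff [multinom e l | l < k] (F * ev k h).
Proof.
elim/mpoly_lin_ind: F => [|c|a F G HF HG].
- by rewrite linear0 form0l mul0r mpoly.mcoeff0.
- rewrite PhiX [_ * ev k h]mulrC mcoeffMX_sub; case: ifP => [/forallP ce|/negP ce].
    rewrite -form_gpol; congr form; apply: eq_bigr => l _.
    by have := ce l; rewrite !mpoly.mnmE /gs => ->.
  have [l lc] : exists l, ~~ (c l <= e l)%N.
    apply/existsP; rewrite -negb_forall; apply/negP => /forallP H; apply: ce.
    by apply/forallP => l; rewrite mpoly.mnmE.
  by rewrite (bigD1 l) //= /gs (negPf lc) mul0r form0l.
- rewrite linearP /= formDl formZl HF HG mulrDl mpoly.mcoeffD -scalerAl.
  by rewrite mpoly.mcoeffZ.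
Qed.

End Reproducing.

(** * Divided differences *)

Section CompleteSymmetric.
Variable R : comNzRingType.

(* The complete homogeneous symmetric polynomial of degree [a] in the entries of [s],
   repetitions allowed: the coefficient of t^a in prod_(z <- s) (1 - t z)^(-1). *)
Fixpoint hsym (s : seq R) (a : nat) : R :=
  if s is z :: s' then \sum_(b < a.+1) z ^+ (a - b) * hsym s' b else (a == 0%N)%:R.

Lemma hsym_cons0 z s : hsym (z :: s) 0 = hsym s 0.
Proof. by rewrite /= big_ord1 mul1r. Qed.

Lemma hsym_consS z s a : hsym (z :: s) a.+1 = z * hsym (z :: s) a + hsym s a.+1.
Proof.
rewrite /= big_ord_recr /= subnn mul1r mulr_sumr; congr (_ + _).
by apply: eq_bigr => b _; rewrite mulrA -exprS subSn // -ltnS.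
Qed.

Lemma hsym_consE z s a : hsym (z :: s) a = \sum_(b < a.+1) z ^+ (a - b) * hsym s b.
Proof. by []. Qed.

Lemma hsym_nil a : hsym [::] a = (a == 0%N)%:R.
Proof. by []. Qed.

Arguments hsym : simpl never.

(** Both orders satisfy h_(b+2) = (y + z) h_(b+1) - y z h_b + h_(b+2)(s), a recursion of order two,
    so two consecutive degrees are carried through the induction. *)
Lemma hsym_swap y z s a : hsym (y :: z :: s) a = hsym (z :: y :: s) a.
Proof.
suff H b : hsym (y :: z :: s) b = hsym (z :: y :: s) b /\
           hsym (y :: z :: s) b.+1 = hsym (z :: y :: s) b.+1 by have [] := H a.
elim: b => [|b [IH0 IH1]].
  by rewrite !hsym_consS !hsym_cons0; split => //; ring.
split=> //.
have E u v : hsym (u :: v :: s) b.+2 =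
    u * hsym (u :: v :: s) b.+1 + v * (hsym (u :: v :: s) b.+1 - u * hsym (u :: v :: s) b) +
    hsym s b.+2.
  by rewrite (hsym_consS u) (hsym_consS v s b.+1) [X in v * (X - _)](hsym_consS u); ring.
by rewrite E [RHS]E IH0 IH1; ring.
Qed.

Lemma hsym_perm s t a : perm_eq s t -> hsym s a = hsym t a.
Proof.
have consE z u v : hsym u =1 hsym v -> hsym (z :: u) =1 hsym (z :: v).
  by move=> uv b; rewrite !hsym_consE; apply: eq_bigr => i _; rewrite uv.
suff H : perm_eq s t -> hsym s =1 hsym t by move=> /H.
elim: s t => [|z s IH] t; first by rewrite perm_sym => /perm_nilP ->.
move=> zst; have zt : z \in t by rewrite -(perm_mem zst) mem_head.
have st : perm_eq s (rem z t) by rewrite -(perm_cons z) (perm_trans zst) // perm_to_rem.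
move=> b; rewrite (consE _ _ _ (IH _ st)) => {st IH zst}.
elim: t zt b => // y t IH; rewrite inE /=; have [->//|yz] := eqVneq y z.
move=> /= zt b; rewrite hsym_swap.
exact: consE (IH zt) b.
Qed.

(** In generating functions: 1/(1 - t y) - 1/(1 - t z) = t (y - z) / ((1 - t y)(1 - t z)). *)
Lemma hsym_divdiff y z s a :
  (y - z) * hsym (y :: z :: s) a = hsym (y :: s) a.+1 - hsym (z :: s) a.+1.
Proof.
have H1 := hsym_consS y (z :: s) a; have H2 := hsym_consS z (y :: s) a.
rewrite !(hsym_swap z y) in H2.
have -> : hsym (y :: s) a.+1 = hsym (y :: z :: s) a.+1 - z * hsym (y :: z :: s) a.
  by rewrite H2; ring.
have -> : hsym (z :: s) a.+1 = hsym (y :: z :: s) a.+1 - y * hsym (y :: z :: s) a.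
  by rewrite H1; ring.
by ring.
Qed.

Lemma hsym_newton s a :
  hsym s a *+ a = \sum_(i < a) (\sum_(z <- s) z ^+ i.+1) * hsym s (a.-1 - i).
Proof.
elim: s a => [|z s IHs] a.
  rewrite big1 => [|i _]; last by rewrite big_nil mul0r.
  by rewrite hsym_nil; case: a => [|a]; rewrite ?mulr0n ?mul0rn.
elim: a => [|a IHa]; first by rewrite big_ord0.
have -> : hsym (z :: s) a.+1 *+ a.+1 =
    z * (hsym (z :: s) a *+ a) + z * hsym (z :: s) a + hsym s a.+1 *+ a.+1.
  by rewrite hsym_consS mulrnDl mulrnAr [in LHS]mulrS [LHS]addrAC; ring.
rewrite IHs IHa.
have E1 : \sum_(i < a.+1) z ^+ i.+1 * hsym (z :: s) (a - i) =
    z * hsym (z :: s) a + z * \sum_(i < a) z ^+ i.+1 * hsym (z :: s) (a.-1 - i).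
  rewrite big_ord_recl subn0 expr1; congr (_ + _).
  rewrite mulr_sumr; apply: eq_bigr => i _; rewrite mulrA -exprS lift0.
  by have -> : (a - i.+1 = a.-1 - i)%N by lia.
have E2 (P : nat -> R) : \sum_(i < a.+1) P i * hsym (z :: s) (a - i) =
    z * \sum_(i < a) P i * hsym (z :: s) (a.-1 - i) + \sum_(i < a.+1) P i * hsym s (a - i).
  rewrite big_ord_recr [X in _ = _ + X]big_ord_recr -[nat_of_ord ord_max]/a.
  rewrite subnn hsym_cons0 addrA.
  congr (_ + _); rewrite mulr_sumr -big_split; apply: eq_bigr => i _ /=.
  have -> : (a - i = (a.-1 - i).+1)%N by have := ltn_ord i; lia.
  by rewrite hsym_consS; ring.
under [RHS]eq_bigr => i _ do rewrite big_cons mulrDl.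
rewrite big_split /= E1 (E2 (fun i => \sum_(y <- s) y ^+ i.+1)).
under eq_bigr => i _ do rewrite big_cons mulrDl.
rewrite big_split /=.
by ring.
Qed.

Lemma hsym_nseq n z a : exists c : nat, hsym (nseq n z) a = c%:R * z ^+ a.
Proof.
elim: n a => [|n IH] a; rewrite ?hsym_consE /=.
  by rewrite hsym_nil; case: a => [|a]; [exists 1%N; rewrite mulr1 | exists 0%N; rewrite mul0r].
elim: {-2}a.+1 (leqnn a.+1) => [|b IHb] ba; first by exists 0%N; rewrite big_ord0 mul0r.
have [|c1 H1] := IHb; first by lia.
have [c2 H2] := IH b.
exists (c1 + c2)%N; rewrite big_ord_recr /= H1 H2 mulrCA -exprD subnK; last by lia.
by rewrite natrD mulrDl.
Qed.

End CompleteSymmetric.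

Arguments hsym {R} s a : simpl never.

(** * Membership in the ideals generated by powers of the variables *)

Section Vanishing.
Variables (C : comNzRingType) (k : nat).
Local Notation MP := (mpoly.mpoly k C).
Local Notation x_ i := (mpoly.mpolyX C (mpoly.mnm1 i)).

(* [F] is in the ideal generated by the [b]-th powers of the variables. *)
Definition max_exp_ge (b : nat) (F : MP) : Prop :=
  forall e : mpoly.multinom k, (forall l, (e l < b)%N) -> mpoly.mcoeff e F = 0.

Lemma max_exp_geD b F G : max_exp_ge b F -> max_exp_ge b G -> max_exp_ge b (F + G).
Proof. by move=> HF HG e eb; rewrite mpoly.mcoeffD HF // HG // addr0. Qed.

Lemma max_exp_geM b F G : max_exp_ge b F -> max_exp_ge b (F * G).
Proof.
move=> HF e eb; rewrite mpoly.mcoeffM big1 // => -[c c'] /= /eqP ec.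
rewrite HF ?mul0r // => l; apply: leq_ltn_trans (eb l).
by rewrite [X in (_ <= fun_of_multinom X _)%N]ec mpoly.mnmDE leq_addr.
Qed.

Lemma max_exp_geX b l : (0 < k)%N -> max_exp_ge b (x_ l ^+ b).
Proof.
move=> k0 e eb; rewrite mpoly.mpolyXn mpoly.mcoeffX; case: eqP => // E.
by have := eb l; rewrite -E mpoly.mulmnE mpoly.mnm1E eqxx mul1n ltnn.
Qed.

Lemma max_exp_geW b b' F : (b' <= b)%N -> max_exp_ge b F -> max_exp_ge b' F.
Proof. by move=> bb HF e eb; apply: HF => l; apply: leq_trans (eb l) bb. Qed.

(** If every index occurs m times in [s], this is Delta^(2m) up to sign. For a general list it is a
    stock of differences that shrinks with the list, one row per removed index. *)
Definition pairprod (s : seq 'I_k) : MP :=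
  \prod_(i <- s) \prod_(j < k | j != i) (x_ i - x_ j).

(* Each use of [hsym_divdiff] removes one variable, raises the degree by one and
   consumes one factor x_i - x_j, until a single variable remains, with multiplicity
   at most [m]. *)
Lemma max_exp_ge_pairprod m (s : seq 'I_k) a : (0 < k)%N ->
  (forall i, (count_mem i s <= m)%N) ->
  max_exp_ge (a + size s - m) (pairprod s * hsym [seq x_ i | i <- s] a).
Proof.
move=> k0; have [n] := ubnP (size s); elim: n s a => // n IH s a sn cs.
have i0 : 'I_k by exact: Ordinal k0.
have [s1|] := boolP (all (pred1 (head i0 s)) s).
  set j := head i0 s in s1; have /all_pred1P sE := s1.
  have sm : (size s <= m)%N by apply: leq_trans (cs j); move: s1; rewrite all_count => /eqP ->.
  (* All entries equal x_j, so the complete polynomial is a multiple of x_j^a; since [size s <= m],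
     the claimed exponent is at most a. *)
  rewrite mulrC; apply: max_exp_geM; rewrite sE map_nseq.
  have [c ->] := hsym_nseq (size s) (x_ j : MP) a.
  rewrite mulrC; apply: max_exp_geM; rewrite size_nseq.
  apply: (@max_exp_geW a); last exact: max_exp_geX.
  by rewrite leq_subLR addnC leq_add2r.
case: s sn cs => [//|i s] sn cs; rewrite [X in ~~ X]/= eqxx => /allPn[j js /= ji].
pose t := rem j s; have st : perm_eq (i :: s) [:: i, j & t] by rewrite perm_cons perm_to_rem.
have -> : pairprod (i :: s) = pairprod [:: i, j & t] by exact: perm_big.
have -> : hsym [seq x_ l : MP | l <- i :: s] a = hsym [seq x_ l | l <- [:: i, j & t]] a.
  by apply: hsym_perm; exact: perm_map.
have sz : size s = (size t).+1 by have := perm_size st => /= -[].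
rewrite sz /=.
have ct l : (count_mem l [:: i, j & t] <= m)%N by rewrite -(permP st).
pose al i' j' : MP := \prod_(l < k | (l != i') && (l != j')) (x_ i' - x_ l).
have EQ i' j' u : i' != j' -> pairprod (i' :: u) = (x_ i' - x_ j') * al i' j' * pairprod u.
  by move=> ij'; rewrite /pairprod big_cons (bigD1 j') // eq_sym.
have ij : i != j by rewrite eq_sym.
have IHi := IH (i :: t) a.+1; have IHj := IH (j :: t) a.+1.
(* Of the two factors x_i - x_j and x_j - x_i, one pays for the divided difference and the other
   completes the row of i, respectively j, in the shorter list. What is left of the other row, [al],
   is a mere cofactor. *)
have -> : pairprod [:: i, j & t] * hsym [:: x_ i, x_ j & [seq x_ l | l <- t]] a =
   pairprod (i :: t) * hsym (x_ i :: [seq x_ l | l <- t]) a.+1 * (- al j i) +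
   pairprod (j :: t) * hsym (x_ j :: [seq x_ l | l <- t]) a.+1 * (- al i j).
  rewrite (EQ i j (j :: t) ij) !(EQ j i t ji) (EQ i j t ij).
  have H := hsym_divdiff (x_ i : MP) (x_ j) [seq x_ l | l <- t] a.
  transitivity ((x_ i - x_ j) * hsym [:: x_ i, x_ j & [seq x_ l | l <- t]] a *
     (al i j * ((x_ j - x_ i) * al j i * pairprod t))); first by ring.
  by rewrite H; ring.
have -> : (a + (size t).+2 - m = a.+1 + (size t).+1 - m)%N by lia.
apply: max_exp_geD; apply: max_exp_geM.
  apply: IHi => [|l]; first by move: sn; rewrite /= sz ltnS.
  by apply: leq_trans (ct l); rewrite /= leq_add2l leq_addl.
apply: IHj => [|l]; first by move: sn; rewrite /= sz ltnS.
by apply: leq_trans (ct l); rewrite /= leq_addl.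
Qed.

End Vanishing.

(** * Powers of the Vandermonde determinant *)

Lemma prod_neq_lt (R : Type) (idx : R) (op : Monoid.com_law idx) k (f : 'I_k -> 'I_k -> R) :
  \big[op/idx]_(i < k) \big[op/idx]_(j < k | j != i) f i j =
  \big[op/idx]_(i < k) \big[op/idx]_(j < k | (j < i)%N) op (f i j) (f j i).
Proof.
under [RHS]eq_bigr => i _ do rewrite big_split.
rewrite big_split /= [X in op _ X](exchange_big_dep xpredT) //= -big_split /=.
apply: eq_bigr => i _; rewrite (bigID (fun j : 'I_k => (j < i)%N)) /=.
congr (op _ _); apply: eq_bigl => j; rewrite -(inj_eq val_inj) /=; lia.
Qed.

Section Vandermonde.
Variables (C : numClosedFieldType) (k : nat).
Local Notation MP := (mpoly.mpoly k C).
Local Notation x_ i := (mpoly.mpolyX C (mpoly.mnm1 i)).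

(* The constant term of F(z) G(1/z). *)
Definition cdot (F G : MP) : C := mplin (fun c => mpoly.mcoeff c G : C^o) F.
Lemma cdotDl F F' G : cdot (F + F') G = cdot F G + cdot F' G.
Proof. by rewrite /cdot linearD. Qed.
Lemma cdotBl F F' G : cdot (F - F') G = cdot F G - cdot F' G.
Proof. by rewrite /cdot linearB. Qed.
Lemma cdotZl a F G : cdot (a *: F) G = a * cdot F G.
Proof. by rewrite /cdot linearZZ. Qed.
Lemma cdot0l G : cdot 0 G = 0.
Proof. by rewrite /cdot linear0. Qed.
Lemma cdotXl c G : cdot (mpoly.mpolyX C c) G = mpoly.mcoeff c G.
Proof. by rewrite /cdot mplinX. Qed.

Lemma cdotBr F G G' : cdot F (G - G') = cdot F G - cdot F G'.
Proof.
by rewrite /cdot /mplin -sumrB; apply: eq_bigr => c _; rewrite mpoly.mcoeffB scalerBr.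
Qed.

Lemma cdotMX F G c : cdot (F * mpoly.mpolyX C c) (G * mpoly.mpolyX C c) = cdot F G.
Proof.
elim/mpoly_lin_ind: F => [|d|a F F' HF HF'].
- by rewrite mul0r !cdot0l.
- by rewrite -mpoly.mpolyXD !cdotXl mpoly.addmC mpoly.mcoeffMX.
- by rewrite mulrDl -scalerAl !cdotDl !cdotZl HF HF'.
Qed.

(* For a product [D] of differences of variables, [D(1/z)] is, up to sign, [D(z)]
   divided by a monomial [M]: the factor [D] moves across the pairing. *)
Definition selfrec (D M : MP) : Prop :=
  exists s : C, forall F G, cdot (F * D) (G * D) = s * cdot (F * (D * D)) (G * M).

Lemma selfrec1 : selfrec 1 1.
Proof. by exists 1 => F G; rewrite !mulr1 mul1r. Qed.

Lemma selfrecM D D' M M' : selfrec D M -> selfrec D' M' -> selfrec (D * D') (M * M').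
Proof.
move=> [s H] [s' H']; exists (s' * s) => F G.
rewrite [F * _]mulrA [G * (D * _)]mulrA H' -[RHS]mulrA; congr (_ * _).
have -> : F * D * (D' * D') = F * (D' * D') * D by ring.
have -> : G * D * M' = G * M' * D by ring.
rewrite H; congr (s * cdot _ _); by ring.
Qed.

Lemma selfrecX D M n : selfrec D M -> selfrec (D ^+ n) (M ^+ n).
Proof.
move=> H; elim: n => [|n IH]; first by rewrite !expr0; exact: selfrec1.
by rewrite !exprS; exact: selfrecM.
Qed.

(** The scalar -1 comes from 1/z_i - 1/z_j = - (z_i - z_j) / (z_i z_j). *)
Lemma selfrec_diff i j : selfrec (x_ i - x_ j) (x_ i * x_ j).
Proof.
exists (-1) => F G.
have -> : F * ((x_ i - x_ j) * (x_ i - x_ j)) =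
  F * x_ i * x_ i - F * x_ i * x_ j - (F * x_ i * x_ j - F * x_ j * x_ j) by ring.
have T1 : cdot (F * x_ i * x_ i) (G * (x_ i * x_ j)) = cdot (F * x_ i) (G * x_ j).
  by rewrite [x_ i * x_ j]mulrC mulrA cdotMX.
have T2 : cdot (F * x_ i * x_ j) (G * (x_ i * x_ j)) = cdot F G.
  by rewrite mulrA !cdotMX.
have T3 : cdot (F * x_ j * x_ j) (G * (x_ i * x_ j)) = cdot (F * x_ j) (G * x_ i).
  by rewrite mulrA cdotMX.
by rewrite !mulrBr !cdotBl !cdotBr T1 T2 T3 !cdotMX; ring.
Qed.

Definition vdmX (n : nat) : MP := \prod_(i < k) \prod_(j < k | (j < i)%N) (x_ i - x_ j) ^+ n.

(** Each variable lies in k - 1 pairs, which gives the exponent n (k - 1). *)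
Lemma selfrec_vdm n :
  selfrec (vdmX n) (mpoly.mpolyX C [multinom (n * k.-1)%N | l < k]).
Proof.
have -> : mpoly.mpolyX C [multinom (n * k.-1)%N | l < k] =
    \prod_(i < k) \prod_(j < k | (j < i)%N) (x_ i * x_ j) ^+ n.
  under [RHS]eq_bigr => i _ do under eq_bigr => j _ do rewrite exprMn.
  rewrite -(prod_neq_lt _ (fun i j => x_ i ^+ n)) mpoly.mpolyXE_id; apply: eq_bigr => i _.
  rewrite mpoly.mnmE prodr_const exprM; congr (_ ^+ _).
  have <- : #|predC1 i| = k.-1 by rewrite cardC1 card_ord.
  exact: eq_card.
rewrite /vdmX; apply: (big_ind2 selfrec); [exact: selfrec1 | by move=> *; exact: selfrecM |] => i _.
apply: (big_ind2 selfrec); [exact: selfrec1 | by move=> *; exact: selfrecM |] => j _.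
by apply: selfrecX; exact: selfrec_diff.
Qed.

Lemma vdmX_neq0 n : vdmX n != 0.
Proof.
apply/prodf_neq0 => i _; apply/prodf_neq0 => j ji; rewrite expf_neq0 // subr_eq0.
apply/eqP => /(congr1 (mpoly.mcoeff (mpoly.mnm1 i))) /eqP.
rewrite !mpoly.mcoeffX eqxx mpoly.eq_mnm1; case: (eqVneq j i) ji => [->|_ _].
  by rewrite ltnn.
by rewrite oner_eq0.
Qed.

Lemma vdmX_conj n : mpoly.map_mpoly Num.conj (vdmX n) = vdmX n.
Proof.
rewrite rmorph_prod; apply: eq_bigr => i _; rewrite rmorph_prod; apply: eq_bigr => j _.
by rewrite rmorphXn rmorphB /= !mpoly.map_mpolyX.
Qed.

Lemma cdot_conj_eq0 F : cdot F (mpoly.map_mpoly Num.conj F) = 0 -> F = 0.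
Proof.
rewrite /cdot /mplin => H; apply/eqP; rewrite -mpoly.msupp_eq0.
case E : (mpoly.msupp F) => [//|c s]; exfalso.
have cF : c \in mpoly.msupp F by rewrite E mem_head.
have := H; rewrite big_seq => /eqP; rewrite psumr_eq0 => [|d _]; last first.
  by rewrite mpoly.mcoeff_map_mpoly /=; exact: mul_conjC_ge0.
move=> /allP /(_ c cF); rewrite cF mpoly.mcoeff_map_mpoly /=.
by rewrite -[_ *: _]/(_ * _) mul_conjC_eq0 mpoly.mcoeff_eq0 cF.
Qed.

(** The monomial clearing Delta(1/z)^n has exponent n (k - 1) in each variable. So the constant term
    pairs coefficients of conj F at c' with coefficients of Delta^(2n) F at c' + n (k - 1), and the
    degree hypothesis on F keeps these exponents below p. *)
Lemma vdm_sqr_faithful n p (F : MP) :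
  (forall c l, c \in mpoly.msupp F -> (c l + n * k.-1 < p)%N) ->
  (forall e : mpoly.multinom k, (forall l, (e l < p)%N) -> mpoly.mcoeff e (vdmX (2 * n) * F) = 0) ->
  F = 0.
Proof.
move=> degF FV; set D := vdmX n.
suff : F * D = 0 by move/eqP; rewrite mulf_eq0 (negPf (vdmX_neq0 n)) orbF => /eqP.
apply: cdot_conj_eq0; rewrite rmorphM /= vdmX_conj.
have [s ->] := selfrec_vdm n.
have -> : F * (vdmX n * vdmX n) = vdmX (2 * n) * F.
  rewrite mulrC; congr (_ * _); rewrite -big_split; apply: eq_bigr => i _.
  by rewrite /= -big_split; apply: eq_bigr => j _; rewrite /= -exprD mul2n addnn.
rewrite /cdot /mplin big1 ?mulr0 // => c _.
rewrite mcoeffMX_sub; case: ifP => [/forallP cge|]; last by rewrite scaler0.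
rewrite mpoly.mcoeff_map_mpoly /=.
set c' := [multinom _ | _ < k]; have [c'F|] := boolP (c' \in mpoly.msupp F); last first.
  by rewrite -mpoly.mcoeff_eq0 => /eqP ->; rewrite rmorph0 scaler0.
rewrite FV ?scale0r // => l; have := degF _ l c'F; have := cge l.
by rewrite !mpoly.mnmE => cl; rewrite subnK.
Qed.

End Vandermonde.

(** * Vanishing of low coefficients of Delta^(2m) g_a *)

Section VandermondeVanishing.
Variables (C : numClosedFieldType) (m : nat) (A : psum_algebra C m).
Local Notation ev := (@ps_ev C m A).
Local Notation MP k := (mpoly.mpoly k C).
Local Notation x_ i := (mpoly.mpolyX C (mpoly.mnm1 i)).

Definition copies k : seq 'I_k := flatten [seq nseq m i | i <- enum 'I_k].

Lemma big_copies (R : comNzRingType) k (f : 'I_k -> R) :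
  \prod_(i <- copies k) f i = \prod_(i < k) f i ^+ m.
Proof.
rewrite big_flatten big_map big_enum; apply: eq_bigr => i _ /=.
by rewrite big_nseq iter_mulr_1.
Qed.

Lemma sum_copies (R : nmodType) k (f : 'I_k -> R) :
  \sum_(i <- copies k) f i = \sum_(i < k) f i *+ m.
Proof.
rewrite big_flatten big_map big_enum; apply: eq_bigr => i _ /=.
by rewrite big_nseq iter_addr_0.
Qed.

Lemma size_copies k : size (copies k) = (m * k)%N.
Proof.
rewrite size_flatten /shape -map_comp (eq_map (g := fun=> m)) => [|l /=]; last by rewrite size_nseq.
by rewrite sumnE big_map big_enum sum_nat_const card_ord mulnC.
Qed.

Lemma count_copies k (i : 'I_k) : (count_mem i (copies k) <= m)%N.
Proof.
rewrite -sum1_count big_mkcond sum_copies (bigD1 i) //= eqxx big1 => [|j /negPf ->].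
  by rewrite addr0 natn.
by rewrite mul0rn.
Qed.

(** Taking each variable m times turns prod_j (1 - t z_j)^(-m) into the generating function of
    complete symmetric polynomials; both sides obey Newton's recursion. *)
Lemma ev_gpol k a : ev k (gpol A a) = hsym [seq x_ i | i <- copies k] a.
Proof.
have [b] := ubnP a; elim: b a => // b IH [|a] ab.
  rewrite gpol0 rmorph1; elim: (copies k) => [|i s IHs] //=.
  by rewrite hsym_cons0.
suff : ev k (gpol A a.+1) *+ a.+1 = hsym [seq x_ i | i <- copies k] a.+1 *+ a.+1.
  rewrite -!scaler_nat => /(congr1 (fun x => (a.+1%:R)^-1 *: x)).
  by rewrite !scalerA mulVf ?pnatr_eq0 // !scale1r.
rewrite hsym_newton -linearMn gpol_rec linear_sum; apply: eq_bigr => i _.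
rewrite linearZZ rmorphM /= ps_ev_var IH; last by lia.
rewrite big_map sum_copies scaler_nat -mulrnAl; congr (_ * _).
by rewrite /psum sumrMnl.
Qed.

Lemma pairprod_copies k : pairprod C (copies k) =
  (\prod_(i < k) \prod_(j < k | (j < i)%N) (-1) ^+ m) * vdm2 C m k.
Proof.
rewrite /pairprod big_copies.
under eq_bigr => i _ do rewrite -prodrXl.
rewrite prod_neq_lt -big_split; apply: eq_bigr => i _; rewrite -big_split; apply: eq_bigr => j _ /=.
by rewrite -[x_ j - x_ i]opprB [in LHS]exprNn mulrCA -exprD addnn mul2n.
Qed.

(** The list [copies k] has length mk, so the bound a + size - m becomes a + (k - 1) m. The sign
    relating [pairprod] to Delta^(2m) squares to 1 and is moved into the cofactor. *)
Lemma vdm2_gpol_vanish k a (F : MP k) (e : mpoly.multinom k) : (0 < k)%N ->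
  (forall l, (e l < a + m * k - m)%N) -> mpoly.mcoeff e (vdm2 C m k * (ev k (gpol A a) * F)) = 0.
Proof.
move=> k0 ea; have H := @max_exp_ge_pairprod C k m (copies k) a k0 (@count_copies k).
rewrite size_copies pairprod_copies in H.
set sg := \prod_(i < k) _ in H.
have sg2 : sg * sg = 1.
  rewrite /sg -big_split big1 // => i _; rewrite -big_split big1 // => j _ /=.
  by rewrite -exprMn mulrNN mulr1 expr1n.
rewrite ev_gpol.
have -> : vdm2 C m k * (hsym [seq x_ i | i <- copies k] a * F) =
   sg * vdm2 C m k * hsym [seq x_ i | i <- copies k] a * (sg * F).
  by rewrite -[LHS]mul1r -sg2; ring.
exact: (max_exp_geM (sg * F) H).
Qed.

End VandermondeVanishing.

(** * Partitions and Jack polynomials *)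

Section IntegerPartitions.
Implicit Types u l : intpart.

Lemma intpart_sorted u : sorted geq u.
Proof. by case: u => s /= /andP[]. Qed.

Lemma intpart_pos u d : d \in parts u -> (0 < d)%N.
Proof. by case: u => s /= /andP[_ s0] ds; rewrite lt0n; apply: contraNneq s0 => <-. Qed.

Lemma intpart_nth0 u i : (nth 0 u i <= nth 0 u 0)%N.
Proof.
have [iu|] := ltnP i (size u); last by move=> ui; rewrite nth_default.
have tr : transitive geq by move=> x y z /= xy zx; apply: leq_trans zx xy.
apply: (@sorted_leq_nth _ geq tr leqnn 0%N u (intpart_sorted u) 0%N i) => //.
by rewrite inE; apply: leq_ltn_trans iu.
Qed.

Lemma intpart_perm u l : perm_eq u l -> u = l.
Proof.
move=> ul; apply: val_inj; apply: (sorted_eq (leT := geq)) ul.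
- by move=> x y z /= xy zx; apply: leq_trans zx xy.
- by move=> x y /= /andP[xy yx]; apply/eqP; rewrite eqn_leq yx xy.
- exact: intpart_sorted.
- exact: intpart_sorted.
Qed.

Lemma leq_size_sumn u : (size u <= sumn u)%N.
Proof.
have := @intpart_pos u; elim: (parts u) => //= x s IH pos.
have x0 : (0 < x)%N by apply: pos; rewrite mem_head.
have : (size s <= sumn s)%N by apply: IH => d ds; apply: pos; rewrite inE ds orbT.
by lia.
Qed.

Lemma leq_mem_sumn (s : seq nat) d : d \in s -> (d <= sumn s)%N.
Proof. by elim: s => //= x s IH; rewrite inE => /orP[/eqP ->|/IH]; lia. Qed.

Lemma dominates_nth0 l u : dominates l u -> (nth 0 u 0 <= nth 0 l 0)%N.
Proof.
move=> [_ /(_ 1%N)]; case: (parts u) => [|x s]; case: (parts l) => [|y t] //=;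
  rewrite ?take0 /= ?addn0 //.
Qed.

Lemma dominates_size l u : dominates l u -> (size l <= size u)%N.
Proof.
move=> [e /(_ (size u))]; rewrite take_size leqNgt => H; rewrite leqNgt.
apply: contra H => ul; rewrite e -[X in (_ < sumn X)%N](cat_take_drop (size u) l) sumn_cat.
rewrite -[X in (X < _)%N]addn0 ltn_add2l.
have : nth 0 l (size u) \in drop (size u) l.
  by rewrite (drop_nth 0) // mem_head.
by move=> /leq_mem_sumn; apply: leq_trans; apply: (@intpart_pos l); apply: mem_nth.
Qed.

Lemma sumn_takeS (s : seq nat) i : sumn (take i.+1 s) = (sumn (take i s) + nth 0 s i)%N.
Proof.
have [iz|zi] := ltnP i (size s); first by rewrite (take_nth 0) // -cats1 sumn_cat /= addn0.
by rewrite nth_default // addn0 !take_oversize // ltnW.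
Qed.

Lemma intpart_take_inj u l : (forall i, sumn (take i u) = sumn (take i l)) -> u = l.
Proof.
move=> E; have N i : nth 0 u i = nth 0 l i.
  by have := E i.+1; rewrite !sumn_takeS E => /addnI.
have S u' l' : (forall i, nth 0 u' i = nth 0 l' i) -> (size l' <= size u')%N.
  move=> N'; rewrite leqNgt; apply/negP => ul.
  have /intpart_pos : nth 0 l' (size u') \in parts l' by apply: mem_nth.
  by rewrite -N' nth_default.
apply: val_inj; apply: (@eq_from_nth _ 0) => //=.
by apply/eqP; rewrite eqn_leq !S.
Qed.

(* A linear extension of the dominance order. *)
Definition dom_rank u : nat := (\sum_(i < sumn u) sumn (take i u))%N.

Lemma dom_rank_lt l u : dominates l u -> u <> l -> (dom_rank u < dom_rank l)%N.
Proof.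
move=> [e dom] ul; rewrite /dom_rank e ltn_neqAle; apply/andP; split; last first.
  by apply: leq_sum => i _; exact: dom.
apply/negP => /eqP E; apply: ul; apply: intpart_take_inj => i.
have [il|li] := ltnP i (sumn l); last first.
  by rewrite !take_oversize // (leq_trans (leq_size_sumn _)) // e.
have H := leqif_sum (P := xpredT) (fun (i : 'I_(sumn l)) _ => leqif_eq (dom i)).
by move/eqP: E; rewrite H.2 => /forallP /(_ (Ordinal il)) /eqP.
Qed.

Fixpoint bounded_seqs (d n : nat) : seq (seq nat) :=
  if n is n'.+1 then [::] :: [seq x :: s | x <- iota 0 d.+1, s <- bounded_seqs d n']
  else [:: [::]].

Lemma mem_bounded_seqs d n s : (size s <= n)%N -> (forall x, x \in s -> (x <= d)%N) ->
  s \in bounded_seqs d n.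
Proof.
elim: n s => [|n IH] s sn sd; first by case: s sn {sd}.
have -> : bounded_seqs d n.+1 =
  [::] :: [seq x :: s | x <- iota 0 d.+1, s <- bounded_seqs d n] by [].
case: s sn sd => [|x s] sn sd; first by rewrite mem_head.
rewrite in_cons; apply/orP; right; apply: allpairs_f.
  by rewrite mem_iota add0n ltnS sd // mem_head.
by apply: IH => // y ys; apply: sd; rewrite inE ys orbT.
Qed.

Lemma intpart_upto d : exists s : seq intpart, uniq s /\ forall u, (u \in s) = (sumn u <= d)%N.
Proof.
exists (undup [seq u <- pmap insub (bounded_seqs d d) | (sumn (parts u) <= d)%N]).
split; first exact: undup_uniq.
move=> u; rewrite mem_undup mem_filter; case: leqP => //= ud.
rewrite mem_pmap_sub /=; apply: mem_bounded_seqs.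
  exact: leq_trans (leq_size_sumn u) ud.
by move=> x xu; apply: leq_trans ud; exact: leq_mem_sumn.
Qed.

(** Parts decrease, so the first one decides; for k = 0 there is no row to test and N may have
    either sign. *)
Lemma in_rectE (N : int) k u :
  in_rect N k u = (size u <= k)%N && ((k == 0%N) || ((nth 0%N u 0)%:Z <= N)).
Proof.
rewrite /in_rect; case: leqP => //= uk; case: k uk => [|k] uk /=.
  by apply/forallP => -[].
apply/forallP/idP => [/(_ ord0) //|H i].
by have := intpart_nth0 u i; lia.
Qed.

End IntegerPartitions.

Lemma seq_argmax (T : eqType) (f : T -> nat) (s : seq T) : s != [::] ->
  exists2 l, l \in s & forall u, u \in s -> (f u <= f l)%N.
Proof.
elim: s => // x s IH _; have [->|/IH[l ls lmax]] := eqVneq s [::].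
  by exists x => [|u]; rewrite inE // => /eqP ->.
have [xl|lx] := leqP (f x) (f l).
  exists l => [|u]; first by rewrite inE ls orbT.
  by rewrite inE => /orP[/eqP -> //|/lmax].
exists x => [|u]; first by rewrite mem_head.
by rewrite inE => /orP[/eqP -> //|/lmax ul]; apply: leq_trans ul (ltnW lx).
Qed.

(** * Triangularity of Jack polynomials against the products of the g_d *)

Section JackBasis.
Variables (C : numClosedFieldType) (m : nat) (A : psum_algebra C m).
Hypothesis m_gt0 : (0 < m)%N.
Local Notation L := (ps_alg A).
Local Notation pv := (ps_var A).
Local Notation form := (@ps_form C m A).
Local Notation ev := (@ps_ev C m A).
Local Notation gpol := (gpol A).

Definition gprod (s : seq nat) : L := \prod_(d <- s) gpol d.

Lemma gprod_ord k (d : mpoly.multinom k) : \prod_(l < k) gpol (d l) = gprod (mpoly.multinom_val d).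
Proof.
rewrite /gprod; case: d => t /=; rewrite big_tuple; apply: eq_bigr => l _.
by rewrite mpoly.multinomE.
Qed.

Lemma gprod_filter0 s : gprod [seq d <- s | d != 0%N] = gprod s.
Proof.
rewrite /gprod big_filter big_mkcond; apply: eq_bigr => d _.
by case: eqP => [->|_] //=; rewrite gpol0.
Qed.

Lemma form_gprod k (d : mpoly.multinom k) h :
  form (gprod (mpoly.multinom_val d)) h = mpoly.mcoeff d (ev k h).
Proof. by rewrite -gprod_ord form_gpol. Qed.

Lemma intpart_of_seq (s : seq nat) : exists u : intpart, perm_eq [seq d <- s | d != 0%N] u.
Proof.
pose t := sort geq [seq d <- s | d != 0%N].
have tP : sorted geq t && (0%N \notin t).
  rewrite mem_sort mem_filter eqxx andbT; apply: sort_sorted => x y.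
  exact: leq_total.
by exists (IntPart tP); rewrite /= perm_sym perm_sort.
Qed.

Lemma gprod_form_eq0 v : (forall u : intpart, form (gprod u) v = 0) ->
  forall s, form (gprod s) v = 0.
Proof.
move=> H s; have [u su] := intpart_of_seq s.
by rewrite -gprod_filter0 /gprod (perm_big _ su); exact: H.
Qed.

(** Newton's recursion, solved for m p_(n+1), expresses it through g_(n+1) and the products p_i g_j
    with smaller indices. Hence products of the g_d span the algebra, and the form is
    nondegenerate. *)
Lemma gprod_complete v : (forall u : intpart, form (gprod u) v = 0) -> v = 0.
Proof.
move=> /gprod_form_eq0 H; apply: ps_form_nondeg.
(* The extra factor [gprod s] absorbs the g's that the recursion produces. *)
suff Q f : forall s, form (f * gprod s) v = 0.
  by move=> f; have := Q f [::]; rewrite /gprod big_nil mulr1.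
elim/(@ps_ind C m A): f => [s|a f g Hf Hg s|n f Hf].
- by rewrite mul1r.
- by rewrite mulrDl -scalerAl ps_form_linear Hf Hg mulr0 addr0.
have [b] := ubnP n; elim: b n => // b IH n nb s.
have m0 : m%:R != 0 :> C by rewrite pnatr_eq0 -lt0n.
apply: (mulfI m0); rewrite mulr0 -formZl.
have -> : m%:R *: (pv n * f * gprod s) =
    (f * gprod (n.+1 :: s)) *+ n.+1 -
    \sum_(i < n) m%:R *: (pv i * f * gprod ((n - i)%N :: s)).
  have -> : f * gprod (n.+1 :: s) *+ n.+1 = gpol n.+1 *+ n.+1 * f * gprod s.
    by rewrite /gprod big_cons mulrCA -mulrnAl mulrA.
  rewrite gpol_rec big_ord_recr /= subnn gpol0 mulr1 !mulrDl !mulr_suml.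
  rewrite -!scalerAl addrAC -[X in X - _]/(\sum_(i < n) _) -sumrB big1 ?add0r // => i _.
  apply/eqP; rewrite subr_eq0; apply/eqP; rewrite -!scalerAl; congr (_ *: _).
  by rewrite /gprod big_cons mulrA [_ * f * _]mulrAC.
rewrite formBl formMnl Hf mul0rn form_suml big1 ?subr0 // => i _.
by rewrite formZl IH ?mulr0 //; have := ltn_ord i; lia.
Qed.

Lemma form_bounded v : exists d, forall s, (d < sumn s)%N -> form (gprod s) v = 0.
Proof.
suff [d H] : exists d, forall k (e : mpoly.multinom k), (d < mpoly.mdeg e)%N ->
    mpoly.mcoeff e (ev k v) = 0.
  exists d => s ds; rewrite (form_gprod (mpoly.Multinom (in_tuple s)) v).
  by apply: H; rewrite /mpoly.mdeg /= -sumnE.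
elim/(@ps_ind C m A): v => [|a f g [d Hf] [d' Hg]|n f [d Hf]].
- exists 0%N => k e; rewrite rmorph1 mpoly.mcoeff1; case: eqP => // ->.
  by rewrite mpoly.mdeg0.
- exists (maxn d d') => k e; rewrite gtn_max => /andP[de d'e].
  by rewrite linearP mpoly.mcoeffD mpoly.mcoeffZ Hf // Hg // mulr0 addr0.
exists (d + n.+1)%N => k e de; rewrite rmorphM /= ps_ev_var /psum mulr_suml raddf_sum big1 //= => l _.
rewrite mpoly.mpolyXn mulrC mcoeffMX_sub; case: ifP => // /forallP le; apply: Hf.
have E : e = mpoly.mnm_add (mpoly.mnm_muln (mpoly.mnm1 l) n.+1)
     [multinom (e l0 - mpoly.mnm_muln (mpoly.mnm1 l) n.+1 l0)%N | l0 < k].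
  by apply/mpoly.mnmP => l0; rewrite mpoly.mnmDE mpoly.mnmE subnKC.
by move: de; rewrite {1}E mpoly.mdegD mpoly.mdegMn mpoly.mdeg1; lia.
Qed.

Lemma mcoeff_msymn n (u : intpart) (d : mpoly.multinom n) :
  mpoly.mcoeff d (msymn C n u) =
  (perm_eq [seq e <- mpoly.multinom_val d | e != 0%N] u)%:R.
Proof.
rewrite /msymn raddf_sum /=; under eq_bigr => M _ do rewrite mpoly.mcoeffX.
have [du|ndu] := boolP (perm_eq _ _); last first.
  by rewrite big1 // => M Mu; case: eqP => // Md; rewrite -Md Mu in ndu.
have db : (mpoly.mdeg d < (sumn u).+1)%N.
  rewrite ltnS -(perm_sumn du) sumnE big_filter [leqRHS]big_mkcond /=.
  by apply: leq_sum => i _; case: eqP => [->|].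
rewrite (bigD1 (BMultinom db)) //= eqxx big1 ?addr0 // => M /andP[_ Md].
by case: eqP => // E; case/eqP: Md; apply: val_inj.
Qed.

Variable J : intpart -> L.
Hypothesis J_tri : forall l, exists (s : seq intpart) (c : intpart -> C),
     (forall u, u \in s -> dominates l u /\ u <> l) /\
     forall n, ev n (J l) = msymn C n l + \sum_(u <- s) c u *: msymn C n u.
Hypothesis J_orth : forall l u, l <> u -> form (J l) (J u) = 0.

Lemma dominates_refl l : dominates l l.
Proof. by split. Qed.

Lemma ev_jack_supp k l (d : mpoly.multinom k) : mpoly.mcoeff d (ev k (J l)) != 0 ->
  exists2 u : intpart, perm_eq [seq e <- mpoly.multinom_val d | e != 0%N] u & dominates l u.
Proof.
have [s [c [sl ->]]] := J_tri l.
rewrite mpoly.mcoeffD mcoeff_msymn raddf_sum /= => H.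
have [dl|ndl] := boolP (perm_eq [seq e <- mpoly.multinom_val d | e != 0%N] l).
  by exists l => //; exact: dominates_refl.
have [/hasP[u us du]|/hasPn nh] :=
    boolP (has (fun u : intpart => perm_eq [seq e <- mpoly.multinom_val d | e != 0%N] u) s).
  by exists u => //; case: (sl u us).
move: H; rewrite (negPf ndl) add0r big_seq big1 ?eqxx // => u us.
by rewrite mpoly.mcoeffZ mcoeff_msymn (negPf (nh u us)) mulr0.
Qed.

Lemma intpart_filter0 (u : intpart) : [seq e <- parts u | e != 0%N] = u.
Proof. by apply/all_filterP/allP => d /intpart_pos; rewrite lt0n. Qed.

(** Pairing with [gprod u] reads off the coefficient of m_u; together with [form_gprod_jack1] this
    is the unitriangularity of the J_l. *)
Lemma form_gprod_jack_dom (u l : intpart) : form (gprod u) (J l) != 0 -> dominates l u.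
Proof.
rewrite (form_gprod (mpoly.Multinom (in_tuple u))) => /ev_jack_supp[v /=].
by rewrite intpart_filter0 => /intpart_perm ->.
Qed.

Lemma form_gprod_jack1 (l : intpart) : form (gprod l) (J l) = 1.
Proof.
rewrite (form_gprod (mpoly.Multinom (in_tuple l))).
have [s [c [sl ->]]] := J_tri l.
rewrite mpoly.mcoeffD mcoeff_msymn raddf_sum /= intpart_filter0 perm_refl.
rewrite big_seq big1 ?addr0 // => u us; rewrite mpoly.mcoeffZ mcoeff_msymn /=.
rewrite intpart_filter0; case: (boolP (perm_eq _ _)) => [/intpart_perm lu|]; last by rewrite mulr0.
by case: (sl u us) => _; rewrite lu.
Qed.

Lemma ev_jack_gt_size k (l : intpart) : (k < size l)%N -> ev k (J l) = 0.
Proof.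
move=> kl; apply/mpoly.mpolyP => d; rewrite mpoly.mcoeff0; apply/eqP/negPn/negP.
move=> /ev_jack_supp[u du /dominates_size lu].
have := perm_size du; rewrite size_filter => E.
have : (size u <= k)%N.
  by rewrite -E (leq_trans (count_size _ _)) // size_tuple.
by move=> /(leq_trans lu); rewrite leqNgt kl.
Qed.

Lemma ev_jack_exp k (l : intpart) (d : mpoly.multinom k) i :
  mpoly.mcoeff d (ev k (J l)) != 0 -> (d i <= nth 0 l 0)%N.
Proof.
move=> /ev_jack_supp[u du /dominates_nth0]; apply: leq_trans.
have [->//|di] := eqVneq (d i) 0%N.
have : d i \in parts u.
  by rewrite -(perm_mem du) mem_filter di mpoly.mnm_tnth mem_tnth.
by move=> /(nthP 0%N)[j _ <-]; exact: intpart_nth0.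
Qed.

(** Triangular elimination over a set closed downward in dominance: an element of maximal [dom_rank]
    is removed, which keeps the set closed, and a multiple of its J is subtracted from [v]. *)
Lemma jack_span (s : seq intpart) v : uniq s ->
  (forall l u, l \in s -> dominates l u -> u \in s) ->
  (forall u : intpart, u \notin s -> form (gprod u) v = 0) ->
  exists a : intpart -> C, v = \sum_(l <- s) a l *: J l.
Proof.
have [n] := ubnP (size s); elim: n s v => // n IH s v sn us down H.
have [s0|/(seq_argmax dom_rank)[l ls lmax]] := eqVneq s [::].
  exists (fun _ => 0); rewrite s0 big_nil; apply: gprod_complete => u; apply: H.
  by rewrite s0.
have lnd u : u \in s -> dominates u l -> u = l.
  move=> us'; have [//|/eqP ul] := eqVneq u l => /dom_rank_lt H'.
  have := lmax u us'; rewrite leqNgt H' //.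
  by move=> lu; apply: ul.
have [||l' u|u|a Ea] := IH (rem l s) (v - form (gprod l) v *: J l).
- by rewrite size_rem //; case: (s) ls sn => //= ? ? _; lia.
- exact: rem_uniq.
- rewrite !mem_rem_uniq // !inE => /andP[l'l l's] dl'u; rewrite (down l') // andbT.
  by apply: contraNneq l'l => ul; apply/eqP; apply: lnd; rewrite // -ul.
- rewrite mem_rem_uniq // inE negb_and negbK => /orP[/eqP ->|us'].
    by rewrite ps_form_sym formBl formZl !(ps_form_sym _ (gprod l)) form_gprod_jack1 mulr1 subrr.
  rewrite ps_form_sym formBl formZl !(ps_form_sym _ (gprod u)) H // sub0r.
  have [->|/eqP/eqP nz] := eqVneq (form (gprod u) (J l)) 0; first by rewrite mulr0 oppr0.
  by case/negP: us'; apply: (down l) => //; apply: form_gprod_jack_dom.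
exists (fun u => if u == l then form (gprod l) v else a u).
rewrite (perm_big _ (perm_to_rem ls)) big_cons eqxx /= -[LHS](subrK (form (gprod l) v *: J l)) addrC Ea.
congr (_ + _); rewrite big_seq [RHS]big_seq; apply: eq_bigr => u.
by rewrite mem_rem_uniq // inE => /andP[/negPf ->].
Qed.

(** Pairing with [gprod l], for l of maximal [dom_rank] among the nonzero coefficients, isolates the
    coefficient of J_l. *)
Lemma jack_indep (s : seq intpart) (a : intpart -> C) : uniq s ->
  (forall u, u \in s -> form (gprod u) (\sum_(l <- s) a l *: J l) = 0) ->
  forall l, l \in s -> a l = 0.
Proof.
move=> us H l0 l0s; apply/eqP/negPn/negP => al0.
have ne : [seq l <- s | a l != 0] != [::].
  by apply/eqP => E; have : l0 \in [seq l <- s | a l != 0]; [rewrite mem_filter al0 | rewrite E].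
have [l] := seq_argmax dom_rank ne; rewrite mem_filter => /andP[al ls] lmax.
have := H l ls; rewrite ps_form_sym form_suml (bigD1_seq l) //= big_seq_cond big1 ?addr0.
  rewrite formZl ps_form_sym form_gprod_jack1 mulr1 => E.
  by rewrite E eqxx in al.
move=> u /andP[us' ul]; rewrite formZl.
have [->|au] := eqVneq (a u) 0; first by rewrite mul0r.
have [->|] := eqVneq (form (J u) (gprod l)) 0; first by rewrite mulr0.
rewrite ps_form_sym => /form_gprod_jack_dom /dom_rank_lt H'.
have := lmax u; rewrite mem_filter au us' leqNgt H' => [/(_ isT) //|E].
by rewrite E eqxx in ul.
Qed.

Lemma jack_span_all v : exists (s : seq intpart) (a : intpart -> C), v = \sum_(l <- s) a l *: J l.
Proof.
have [d Hd] := form_bounded v; have [s [us sE]] := intpart_upto d.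
exists s; apply: jack_span => //.
  by move=> l u; rewrite !sE => ld [-> _].
by move=> u; rewrite sE -ltnNge => /Hd.
Qed.

(** The J_u span, so an isotropic J_l would be orthogonal to everything and hence 0, contradicting
    its coefficient 1 at m_l. *)
Lemma form_jack_neq0 l : form (J l) (J l) != 0.
Proof.
apply/eqP => H; have J0 : J l = 0.
  apply: ps_form_nondeg => f; have [s [a ->]] := jack_span_all f.
  rewrite form_suml big1 // => u _; rewrite formZl.
  by have [->|/eqP ul] := eqVneq u l; rewrite ?H ?J_orth ?mulr0.
by have := form_gprod_jack1 l; rewrite J0 ps_form_sym form0l => /eqP; rewrite eq_sym oner_eq0.
Qed.

End JackBasis.

(** * The span of the words *)

Section WordSpan.
Variables (C : numClosedFieldType) (m : nat) (A : psum_algebra C m).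
Hypothesis m_gt0 : (0 < m)%N.
Local Notation L := (ps_alg A).
Local Notation form := (@ps_form C m A).
Local Notation ev := (@ps_ev C m A).
Local Notation gpol := (gpol A).
Local Notation gprod := (gprod A).
Variable J : intpart -> L.
Hypothesis J_tri : forall l, exists (s : seq intpart) (c : intpart -> C),
     (forall u, u \in s -> dominates l u /\ u <> l) /\
     forall n, ev n (J l) = msymn C n l + \sum_(u <- s) c u *: msymn C n u.
Hypothesis J_orth : forall l u, l <> u -> form (J l) (J u) = 0.

Variables (p k : nat).
Let N : int := p%:Z - (k%:Z - 1) * m%:Z - 1.

Lemma rect_width (a : nat) : (0 < k)%N -> (a%:Z <= N) = (a + m * k - m < p)%N.
Proof.
rewrite /N; case: k => // k' _; rewrite mulnS.
have -> : (k'.+1%:Z - 1) * m%:Z = (m * k')%N by rewrite -addn1 PoszD addrK PoszM mulrC.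
by apply/idP/idP; lia.
Qed.

(* The two conditions satisfied by words that confine a vector to the span of the
   Jack polynomials of the rectangle. *)
Definition rect_vec (v : L) : Prop :=
  (forall u : intpart, (0 < k)%N -> ~~ ((nth 0%N u 0)%:Z <= N) -> form (gprod u) v = 0) /\
  (forall l : intpart, (k < size l)%N -> form v (J l) = 0).

Lemma lam_word_rect e : (forall l, (e l < p)%N) -> rect_vec (lam_word A e k).
Proof.
move=> ep; rewrite lam_wordE; split=> [u k0 uN|l kl]; last first.
  by rewrite form_Phi // (ev_jack_gt_size J_tri) // mulr0 mpoly.mcoeff0.
(* Only the factor of the largest part matters. For the empty partition the default part 0 gives g_0
   = 1, which covers the case N < 0. *)
have -> : gprod u = gpol (nth 0 u 0)%N * gprod (behead u).
  rewrite /gprod; case: (parts u) => [|x s] /=; last by rewrite big_cons.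
  by rewrite big_nil gpol0 mulr1.
rewrite ps_form_sym form_Phi // rmorphM; apply: vdm2_gpol_vanish => // l.
rewrite mpoly.mnmE; apply: leq_trans (ep l) _.
by rewrite leqNgt -rect_width.
Qed.

Lemma rect_vec0 : rect_vec 0.
Proof. by split=> *; [rewrite ps_form_sym form0l | rewrite form0l]. Qed.

Lemma rect_vecD a v w : rect_vec v -> rect_vec w -> rect_vec (a *: v + w).
Proof.
move=> [v1 v2] [w1 w2]; split=> [u k0 uN|l kl].
  by rewrite ps_form_sym ps_form_linear !(ps_form_sym _ (gprod u)) v1 // w1 // mulr0 addr0.
by rewrite ps_form_linear v2 // w2 // mulr0 addr0.
Qed.

Lemma rect_vec_sum (I : Type) (r : seq I) (c : I -> C) (v : I -> L) :
  (forall i, rect_vec (v i)) -> rect_vec (\sum_(i <- r) c i *: v i).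
Proof.
move=> H; elim: r => [|i r IH]; first by rewrite big_nil; exact: rect_vec0.
by rewrite big_cons; apply: rect_vecD.
Qed.

Lemma form_jack_sum (s : seq intpart) (a : intpart -> C) l : uniq s ->
  form (\sum_(u <- s) a u *: J u) (J l) = if l \in s then a l * form (J l) (J l) else 0.
Proof.
move=> us; rewrite form_suml; case: ifP => ls.
  rewrite (bigD1_seq l) //= formZl big1 ?addr0 // => u /eqP ul.
  by rewrite formZl J_orth // mulr0.
rewrite big_seq big1 // => u us'; rewrite formZl J_orth ?mulr0 // => ul.
by rewrite -ul us' in ls.
Qed.

Lemma rect_vec_span v : rect_vec v -> exists (s : seq intpart) (a : intpart -> C),
  [/\ uniq s, all (in_rect N k) s & v = \sum_(l <- s) a l *: J l].
Proof.
move=> [v1 v2]; have [d Hd] := form_bounded m_gt0 v; have [s0 [us0 s0E]] := intpart_upto d.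
pose s1 := [seq u <- s0 | (k == 0%N) || ((nth 0%N (parts u) 0)%:Z <= N)].
have us1 : uniq s1 by exact: filter_uniq.
have [l u|u|a Ea] := jack_span m_gt0 J_tri (v := v) us1.
- rewrite !mem_filter !s0E => /andP[lN ld] dlu; case: (dlu) => -> _; rewrite ld andbT.
  case/orP: lN => [->//|lN]; apply/orP; right.
  by have := dominates_nth0 dlu; lia.
- rewrite mem_filter s0E negb_and negb_or -ltnNge => /orP[/andP[k0 uN]|/Hd//].
  by apply: v1; rewrite // lt0n.
exists (filter (in_rect N k) s1), a; split; [exact: filter_uniq | exact: filter_all |].
rewrite big_filter [RHS]big_mkcond Ea big_seq [RHS]big_seq; apply: eq_bigr => l ls1.
(* The width already holds on [s1], so a partition outside the rectangle has more than k rows;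
   pairing with J_l makes its coefficient zero. *)
case: ifP => // lN; have /v2 : (k < size l)%N.
  by move: lN ls1; rewrite in_rectE mem_filter ltnNge => H /andP[H' _]; rewrite H' andbT in H; rewrite H.
rewrite Ea form_jack_sum // ls1 => /eqP; rewrite mulf_eq0 (negPf (form_jack_neq0 m_gt0 J_tri J_orth l)) orbF.
by move=> /eqP ->; rewrite scale0r.
Qed.

Lemma sumn_leq (t : seq nat) b : (forall x, x \in t -> (x <= b)%N) -> (sumn t <= size t * b)%N.
Proof.
elim: t => //= x t IH H; rewrite mulSn leq_add //; first by apply: H; rewrite mem_head.
by apply: IH => y yt; apply: H; rewrite inE yt orbT.
Qed.

Lemma rect_list : exists s : seq intpart, uniq s /\ forall u, (u \in s) = in_rect N k u.
Proof.
have [s0 [us0 s0E]] := intpart_upto (k * absz N)%N.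
exists (filter (in_rect N k) s0); split=> [|u]; first exact: filter_uniq.
rewrite mem_filter; case: (boolP (in_rect N k u)) => //= uN; rewrite s0E.
move: uN; rewrite in_rectE => /andP[uk uN].
have [k0|k0] := posnP k.
  by move: uk; rewrite k0 leqn0 size_eq0 => /eqP ->.
apply: (@leq_trans (size u * absz N)); last by rewrite leq_mul2r uk orbT.
apply: sumn_leq => x /(nthP 0%N)[j _ <-]; apply: leq_trans (intpart_nth0 u j) _.
by move: uN; rewrite eqn0Ngt k0 /=; lia.
Qed.

(** Injectivity of the pairing matrix yields a combination [y] of the [v i] that pairs to 1 with J_l
    and to 0 with the other J_u of the rectangle. As [y] lies in the span of these polynomials,
    orthogonality makes it a nonzero multiple of J_l. *)
Lemma jack_rect_span (F : finType) (v : F -> L) :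
  (forall i, rect_vec (v i)) ->
  (forall f : L, (forall i, form (v i) f = 0) ->
     (forall c l, c \in mpoly.msupp (ev k f) -> (c l + m * k.-1 < p)%N) -> ev k f = 0) ->
  forall l, in_rect N k l -> exists b : F -> C, J l = \sum_i b i *: v i.
Proof.
move=> vR vF l lN; have [R [uR RE]] := rect_list.
pose r := size R.
pose M : 'M[C]_(#|F|, r) := \matrix_(i, j) form (v (enum_val i)) (J (nth l R j)).
have RN (j : 'I_r) : in_rect N k (nth l R j) by rewrite -RE mem_nth.
(* A kernel vector is a combination [f] of the J_u orthogonal to all [v i]; then [f] vanishes in k
   variables, which suffices because the partitions involved have at most k rows. *)
have Mker (c : 'cV[C]_r) : M *m c = 0 -> c = 0.
  move=> Mc; pose a u := if insub (index u R) is Some j then c j 0 else 0.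
  have aE (j : 'I_r) : a (nth l R j) = c j 0.
    by rewrite /a index_uniq // valK.
  pose f := \sum_(u <- R) a u *: J u.
  have fE : f = \sum_(j < r) c j 0 *: J (nth l R j).
    by rewrite /f (big_nth l) big_mkord; apply: eq_bigr => j _; rewrite aE.
  have f0 : ev k f = 0.
    apply: vF => [i|d x].
      have /matrixP /(_ (enum_rank i) 0) := Mc; rewrite !mxE => E.
      rewrite ps_form_sym fE form_suml -[RHS]E; apply: eq_bigr => j _.
      by rewrite formZl mxE enum_rankK mulrC ps_form_sym.
    have [k0|k0] := posnP k; first by have := ltn_ord x; rewrite [X in (_ < X)%N]k0.
    rewrite mpoly.mcoeff_msupp fE linear_sum raddf_sum /= => H.
    have [j jH] : exists j : 'I_r, mpoly.mcoeff d (ev k (J (nth l R j))) != 0.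
      apply/existsP; apply: contraNT H; rewrite negb_exists => /forallP H.
      rewrite big1 // => j _; rewrite linearZZ mpoly.mcoeffZ.
      by have := H j; rewrite negbK => /eqP ->; rewrite mulr0.
    have dx := ev_jack_exp J_tri x jH.
    have := RN j; rewrite in_rectE => /andP[_]; rewrite eqn0Ngt k0 /= rect_width //.
    apply: leq_ltn_trans; have -> : (m * k = m + m * k.-1)%N by rewrite -mulnS prednK.
    by rewrite addnCA addKn leq_add2r.
  have a0 : forall u, u \in R -> a u = 0.
    apply: (jack_indep m_gt0 J_tri uR) => u uR'; rewrite -/f.
    have : (size u <= k)%N by move: uR'; rewrite RE in_rectE => /andP[].
    (* Padding [u] with zeros to length k leaves [gprod u] unchanged since g_0 = 1, and turns the
       pairing into a coefficient of [ev k f]. *)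
    move=> uk; have /eqP st : size (parts u ++ nseq (k - size u) 0%N) == k.
      by rewrite size_cat size_nseq subnKC.
    have /eqP st' := st.
    have <- : gprod (parts u ++ nseq (k - size u) 0%N) = gprod u.
      rewrite /gprod big_cat /= [X in _ * X]big1_seq ?mulr1 // => d /andP[_].
      by rewrite mem_nseq => /andP[_ /eqP ->]; rewrite gpol0.
    by rewrite (form_gprod m_gt0 (mpoly.Multinom (Tuple st'))) f0 mpoly.mcoeff0.
  apply/matrixP => j j'; rewrite ord1 mxE -aE a0 //.
  by rewrite mem_nth.
have Mfull : row_full M.
  rewrite /row_full -mxrank_tr -[_ == _]/(row_free M^T) -kermx_eq0.
  apply/eqP/row_matrixP => i; rewrite row0; apply: trmx_inj; rewrite trmx0.
  apply: Mker; apply: trmx_inj; rewrite trmx_mul trmxK trmx0.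
  by apply: sub_kermxP; exact: row_sub.
have lR : (index l R < r)%N by rewrite index_mem RE.
pose j0 := Ordinal lR.
(* The row of a left inverse of [M] that belongs to l. *)
pose b i := pinvmx M j0 (enum_rank i).
pose y := \sum_i b i *: v i.
have yJ u : u \in R -> form y (J u) = (u == l)%:R.
  move=> uR'; have uI : (index u R < r)%N by rewrite index_mem.
  have /matrixP /(_ j0 (Ordinal uI)) := mulVpmx Mfull; rewrite !mxE.
  rewrite (reindex enum_rank) /=; last by apply: onW_bij; exact: enum_rank_bij.
  rewrite /y form_suml => E.
  rewrite -(inj_eq val_inj) /= in E.
  have -> : (u == l) = (index l R == index u R).
    by apply/eqP/eqP => [->//|E']; rewrite -(nth_index l uR') -E' nth_index // RE.
  rewrite -E; apply: eq_bigr => i _.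
  by rewrite formZl [M _ _]mxE enum_rankK /= nth_index.
have yR : rect_vec y by exact: rect_vec_sum.
have [s [a [us sN yE]]] := rect_vec_span yR.
have lRR : l \in R by rewrite RE.
have := yJ l lRR; rewrite eqxx {1}yE form_jack_sum //; case: ifP => [ls al|_ /eqP]; last first.
  by rewrite eq_sym oner_eq0.
have yE' : y = a l *: J l.
  rewrite yE (bigD1_seq l) //= big_seq_cond big1 ?addr0 // => u /andP[us' ul].
  have uR' : u \in R by rewrite RE; exact: (allP sN).
  have := yJ u uR'; rewrite (negPf ul) yE form_jack_sum // us' => /eqP.
  by rewrite mulf_eq0 (negPf (form_jack_neq0 m_gt0 J_tri J_orth u)) orbF => /eqP ->; rewrite scale0r.
have al0 : a l != 0 by apply/eqP => E; move/eqP: al; rewrite E mul0r eq_sym oner_eq0.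
exists (fun i => (a l)^-1 * b i).
rewrite -[LHS]scale1r -(mulVf al0) -scalerA -yE' /y scaler_sumr.
by apply: eq_bigr => i _; rewrite scalerA.
Qed.

End WordSpan.

(** * Polynomials in the power sums *)

Section Linext.
Variables (C : comNzRingType) (K : choiceType).

Lemma malg_lin_ind (P : {malg C[K]} -> Prop) :
  P 0 -> (forall x, P << x >>) -> (forall a f g, P f -> P g -> P (a *: f + g)) ->
  forall f, P f.
Proof.
move=> P0 PU PL f; rewrite (monalgE f).
elim: (enum_fset _) => [|x s IH]; first by rewrite big_nil.
rewrite big_cons; have -> : << mcoeff x f *g x >> = mcoeff x f *: (<< x >> : {malg C[K]}).
  by apply/malgP => y; rewrite mcoeffZ !mcoeffU mulrnAr mulr1.
exact: PL.
Qed.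

Variables (V : lmodType C) (h : K -> V).

Lemma linextEw (d : {fset K}) (g : {malg C[K]}) : (msupp g `<=` d)%fset ->
  linext h g = \sum_(x <- d) mcoeff x g *: h x.
Proof.
move=> gd; rewrite linext.unlock (big_fset_incl _ gd) // => x _ xg.
by rewrite mcoeff_outdom ?scale0r.
Qed.

Lemma linext_is_linear : linear (linext h).
Proof.
move=> a f g; pose d := (msupp f `|` msupp g)%fset.
rewrite !(@linextEw d) ?fsubsetUl ?fsubsetUr //; last first.
  apply: fsubset_trans (msuppD_le _ _) _; apply: fsetUSS => //.
  exact: msuppZ_le.
rewrite scaler_sumr -big_split; apply: eq_bigr => x _ /=.
by rewrite mcoeffD mcoeffZ scalerDl scalerA.
Qed.

HB.instance Definition _ := GRing.isLinear.Build C {malg C[K]} V *:%R (linext h)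
  linext_is_linear.

Lemma linextU x : linext h << x >> = h x.
Proof.
by rewrite (@linextEw [fset x]%fset) ?msuppU_le // big_seq_fset1 mcoeffUU scale1r.
Qed.

End Linext.

Section CommutativeMonomials.
Implicit Types M N : {cmonom nat}.

Lemma divcmK i M : (0 < M i)%N -> mmul (ucm i) (divcm M (ucm i)) = M.
Proof. by move=> Mi; apply/eqP/cmP => j; rewrite cmM divcmE ucmE; case: eqP => [<-|_]; lia. Qed.

Lemma mulcmK i M : divcm (mmul (ucm i) M) (ucm i) = M.
Proof. by apply/eqP/cmP => j; rewrite divcmE cmM; lia. Qed.

Lemma divcm_mull i M N : (0 < M i)%N -> divcm (mmul M N) (ucm i) = mmul (divcm M (ucm i)) N.
Proof.
by move=> Mi; apply/eqP/cmP => j; rewrite !(cmM, divcmE, ucmE); case: eqP => [<-|_]; lia.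
Qed.

Lemma cmonom_ind (P : {cmonom nat} -> Prop) :
  P mone -> (forall i M, P M -> P (mmul (ucm i) M)) -> forall M, P M.
Proof.
move=> P1 PM M; have [n le_n] := ubnP (mdeg M).
elim: n M le_n => // n IH M; have [->//|] := eqVneq M mone.
rewrite -mdeg_eq0 mdegE => M0 le_n.
have [i iM] : exists i, M i != 0%N.
  case: (fset_0Vmem (finsupp M)) => [M0' | [i iM]]; last by exists i; rewrite cmE_neq0.
  by rewrite M0' big_seq_fset0 in M0.
rewrite -lt0n in iM; rewrite -(divcmK iM); apply: PM; apply: IH.
by move: le_n; rewrite -mdegE -{1}(divcmK iM) mdegM mdegU.
Qed.

Lemma big_cmonom (R : Type) (idx : R) (op : Monoid.com_law idx) M (d : {fset nat})
    (F : nat -> nat -> R) : (forall i, F i 0%N = idx) -> (finsupp M `<=` d)%fset ->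
  \big[op/idx]_(i <- finsupp M) F i (M i) = \big[op/idx]_(i <- d) F i (M i).
Proof.
move=> F0 Md; rewrite (big_fset_incl _ Md) // => i _ iM.
by move: iM; rewrite -cmE_eq0 => /eqP ->.
Qed.

Lemma big_cmonomM (R : Type) (idx : R) (op : Monoid.com_law idx) M N
    (F : nat -> nat -> R) : (forall i, F i 0%N = idx) ->
  (forall i a b, F i (a + b)%N = op (F i a) (F i b)) ->
  \big[op/idx]_(i <- finsupp (mmul M N)) F i (mmul M N i) =
  op (\big[op/idx]_(i <- finsupp M) F i (M i)) (\big[op/idx]_(i <- finsupp N) F i (N i)).
Proof.
move=> F0 FD; pose d := (finsupp M `|` finsupp N)%fset.
rewrite (big_cmonom _ (M := M) (d := d)) ?fsubsetUl // (big_cmonom _ (M := N) (d := d)) ?fsubsetUr //.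
rewrite (big_cmonom _ (d := d)) ?mdomD // -big_split; apply: eq_bigr => i _ /=.
by rewrite cmM FD.
Qed.

Lemma mwgtM M N : mwgt (mmul M N) = (mwgt M + mwgt N)%N.
Proof.
apply: (big_cmonomM _ _ _ (F := fun i a => (i.+1 * a)%N)) => [i|i a b].
  by rewrite muln0.
by rewrite mulnDr.
Qed.

Lemma mwgtU i : mwgt (ucm i) = i.+1.
Proof. by rewrite /mwgt mdomU big_seq_fset1 cmUU muln1. Qed.

Lemma psum_normU (C : numClosedFieldType) (a : C) i M : a != 0 ->
  a * psum_norm a (mmul (ucm i) M) = (i.+1 * (M i).+1)%:R * psum_norm a M.
Proof.
move=> a0; rewrite /psum_norm mdegM mdegU exprS invfM mulrA (mulrA a) divff // mul1r.
rewrite mulrCA; congr (_ * _); rewrite -natrM; congr (_%:R).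
pose F i a := (i.+1 ^ a * a`!)%N.
have F0 j : F j 0%N = 1%N by [].
pose d := (finsupp (ucm i) `|` finsupp M)%fset.
rewrite (big_cmonom muln (F := F) (d := d)) ?mdomD // (big_cmonom muln (F := F) (M := M) (d := d)) ?fsubsetUr //.
have id : i \in d by rewrite in_fsetU mdomU in_fset1 eqxx.
rewrite !(big_fsetD1 i id) /= mulnA; congr (_ * _)%N.
  by rewrite /F cmM cmUU add1n expnS factS mulnACA.
rewrite big_seq [RHS]big_seq; apply: eq_bigr => j; rewrite in_fsetD1 => /andP[ji _].
by rewrite cmM ucmE eq_sym (negPf ji).
Qed.

Lemma psum_norm1 (C : numClosedFieldType) (a : C) : psum_norm a mone = 1.
Proof. by rewrite /psum_norm mdeg1 mdom1 big_seq_fset0 expr0 invr1 mulr1. Qed.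

Lemma psum_norm_neq0 (C : numClosedFieldType) (a : C) M : a != 0 -> psum_norm a M != 0.
Proof.
move=> a0; rewrite /psum_norm mulf_neq0 ?invr_eq0 ?expf_neq0 // pnatr_eq0 -lt0n.
by rewrite prodn_gt0 // => i; rewrite muln_gt0 expn_gt0 fact_gt0.
Qed.

End CommutativeMonomials.

(** * Derivations, evaluations and Jack's form on an algebra with a basis of monomials *)

Section MonomialBasis.
Variables (C : numClosedFieldType) (m : nat) (L : comAlgType C).
Variables (mon : {cmonom nat} -> L)
  (lext : forall V : lmodType C, ({cmonom nat} -> V) -> L -> V).
Hypothesis m_gt0 : (0 < m)%N.
Hypothesis lext_linear : forall V h, linear (@lext V h).
Hypothesis lext_mon : forall V h M, @lext V h (mon M) = h M.
Hypothesis mon1 : mon mone = 1.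
Hypothesis monM : forall M N, mon (mmul M N) = mon M * mon N.
Hypothesis mon_ind : forall P : L -> Prop, P 0 -> (forall M, P (mon M)) ->
  (forall a f g, P f -> P g -> P (a *: f + g)) -> forall f, P f.
Hypothesis mon_sep : forall f,
  (forall M, lext (fun N => (N == M)%:R : C^o) f = 0) -> f = 0.

HB.instance Definition _ (V : lmodType C) h := GRing.isLinear.Build C L V *:%R (@lext V h) (lext_linear h).

Definition mder n : L -> L := lext (fun M => (M n)%:R *: mon (divcm M (ucm n))).
HB.instance Definition _ n := GRing.Linear.on (mder n).

Definition mev k : L -> mpoly.mpoly k C :=
  lext (fun M : {cmonom nat} => \prod_(i <- finsupp M) psum C k i.+1 ^+ M i).
HB.instance Definition _ k := GRing.Linear.on (mev k).

Definition mform (f g : L) : C :=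
  lext (fun M => lext (fun N => (N == M)%:R : C^o) g * psum_norm m%:R M : C^o) f.

Lemma mon_psum_ind (P : L -> Prop) : P 1 ->
  (forall a f g, P f -> P g -> P (a *: f + g)) ->
  (forall n f, P f -> P (mon (ucm n) * f)) -> forall f, P f.
Proof.
move=> P1 PL PM; apply: mon_ind => //.
  by have := PL (-1) 1 1 P1 P1; rewrite scaleN1r addNr.
by apply: cmonom_ind => [|i M PM']; rewrite ?mon1 // monM; apply: PM.
Qed.

Lemma mder_var n i : mder n (mon (ucm i)) = (i == n)%:R.
Proof.
rewrite /mder lext_mon ucmE; case: eqP => [->|_]; last by rewrite scale0r.
have := mulcmK n mone; rewrite mulm1 => ->.
by rewrite mon1 scale1r.
Qed.

Lemma mderM n f g : mder n (f * g) = mder n f * g + f * mder n g.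
Proof.
elim/mon_ind: f => [|M|a f f' Hf Hf'].
- by rewrite !linear0 !mul0r linear0 addr0.
- elim/mon_ind: g => [|N|a g g' Hg Hg'].
  + by rewrite !linear0 !mulr0 linear0 addr0.
  + rewrite -monM /mder !lext_mon cmM natrD scalerDl -scalerAl -scalerAr -!monM.
    congr (_ + _).
      have [->|M0] := posnP (M n); first by rewrite !scale0r.
      by rewrite divcm_mull.
    have [->|N0] := posnP (N n); first by rewrite !scale0r.
    by rewrite mulmC divcm_mull // mulmC.
  + by rewrite mulrDr -scalerAr !linearP /= Hg Hg' !mulrDr -!scalerAr scalerDr addrACA.
- by rewrite mulrDl -scalerAl !linearP /= Hf Hf' !mulrDl -!scalerAl scalerDr addrACA.
Qed.

Lemma mev_monoid_morphism k : monoid_morphism (mev k).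
Proof.
split=> [|f g]; first by rewrite -mon1 /mev lext_mon mdom1 big_seq_fset0.
elim/mon_ind: f => [|M|a f f' Hf Hf'].
- by rewrite mul0r linear0 mul0r.
- elim/mon_ind: g => [|N|a g g' Hg Hg'].
  + by rewrite mulr0 linear0 mulr0.
  + rewrite -monM /mev !lext_mon.
    apply: (big_cmonomM _ _ _ (F := fun i a => psum C k i.+1 ^+ a)) => [i|i a b].
      exact: expr0.
    by rewrite exprD.
  + by rewrite mulrDr -scalerAr !linearP /= Hg Hg' mulrDr -scalerAr.
- by rewrite mulrDl -scalerAl !linearP /= Hf Hf' mulrDl -scalerAl.
Qed.
HB.instance Definition _ k := GRing.isMonoidMorphism.Build L (mpoly.mpoly k C) (mev k)
  (mev_monoid_morphism k).

Lemma mev_var k i : mev k (mon (ucm i)) = psum C k i.+1.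
Proof. by rewrite /mev lext_mon mdomU big_seq_fset1 cmUU expr1. Qed.

Lemma mform_linear h a f g : mform (a *: f + g) h = a * mform f h + mform g h.
Proof. by rewrite /mform linearP. Qed.

Lemma mform_linearr h a f g : mform h (a *: f + g) = a * mform h f + mform h g.
Proof.
rewrite /mform; elim/mon_ind: h => [|M|b h h' Hh Hh'].
- by rewrite !linear0 mulr0 addr0.
- by rewrite !lext_mon linearP /= mulrDl -mulrA.
- rewrite !linearP /= Hh Hh' -!/(_ *: _) /GRing.scale /=; ring.
Qed.

Lemma mform_mon M N : mform (mon M) (mon N) = (N == M)%:R * psum_norm m%:R M.
Proof. by rewrite /mform !lext_mon. Qed.

Lemma mform0l f : mform 0 f = 0. Proof. by rewrite /mform linear0. Qed.

Lemma mform0r f : mform f 0 = 0.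
Proof.
by have := mform_linearr f (-1) 0 0; rewrite scaler0 addr0 mulN1r addNr.
Qed.

Lemma mform_sym f g : mform f g = mform g f.
Proof.
elim/mon_ind: f => [|M|a f f' Hf Hf']; first by rewrite mform0l mform0r.
  elim/mon_ind: g => [|N|a g g' Hg Hg']; first by rewrite mform0l mform0r.
    by rewrite !mform_mon eq_sym; case: eqP => [->|_]; rewrite ?mul0r.
  by rewrite mform_linear mform_linearr Hg Hg'.
by rewrite mform_linear mform_linearr Hf Hf'.
Qed.

Let m_neq0 : m%:R != 0 :> C.
Proof. by rewrite pnatr_eq0 -lt0n. Qed.

Lemma mform_adj n f g :
  m%:R * mform (mon (ucm n) * f) g = n.+1%:R * mform f (mder n g).
Proof.
elim/mon_ind: f => [|M|a f f' Hf Hf'].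
- by rewrite mulr0 !mform0l !mulr0.
- elim/mon_ind: g => [|N|a g g' Hg Hg'].
  + by rewrite linear0 !mform0r !mulr0.
  + rewrite -monM mform_mon /mder lext_mon.
    have -> : mform (mon M) ((N n)%:R *: mon (divcm N (ucm n))) =
        (N n)%:R * ((divcm N (ucm n) == M)%:R * psum_norm m%:R M).
      have := mform_linearr (mon M) (N n)%:R (mon (divcm N (ucm n))) 0.
      by rewrite addr0 mform0r addr0 mform_mon.
    have [->|NM] := eqVneq N (mmul (ucm n) M).
      by rewrite mul1r psum_normU // mulcmK eqxx mul1r cmM cmUU natrM mulrA.
    rewrite mul0r mulr0; have [->|Nn] := posnP (N n); first by rewrite mul0r mulr0.
    case: eqP => [E|_]; last by rewrite mul0r !mulr0.
    by rewrite -E divcmK ?eqxx in NM.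
  + by rewrite linearP /= !mform_linearr !mulrDr !(mulrCA _ a) Hg Hg'.
- by rewrite mulrDr -scalerAr !mform_linear !mulrDr !(mulrCA _ a) Hf Hf'.
Qed.

Lemma mform1 : mform 1 1 = 1.
Proof. by rewrite -mon1 mform_mon eqxx psum_norm1 mulr1. Qed.

Lemma mform_nondeg g : (forall f, mform f g = 0) -> g = 0.
Proof.
move=> H; apply: mon_sep => M; have := H (mon M); rewrite /mform lext_mon => /eqP.
by rewrite mulf_eq0 (negPf (psum_norm_neq0 _ m_neq0)) orbF => /eqP.
Qed.

Definition monomial_psum_algebra : psum_algebra C m :=
  {| ps_ind := mon_psum_ind;
     ps_der_linear := fun n => linearP (mder n);
     ps_derM := mderM;
     ps_der_var := mder_var;
     ps_ev := mev;
     ps_ev_var := mev_var;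
     ps_form_linear := mform_linear;
     ps_form_sym := mform_sym;
     ps_form_adj := mform_adj;
     ps_form1 := mform1;
     ps_form_nondeg := mform_nondeg |}.

End MonomialBasis.

HB.lock Definition psmon (C : nzRingType) (M : {cmonom nat}) : poly_inf C := << M >>.

Section PolyInf.
Variable C : numClosedFieldType.
Local Notation Lam := (poly_inf C).

Lemma linext_psmon (V : lmodType C) (h : {cmonom nat} -> V) M : linext h (psmon C M) = h M.
Proof. by rewrite psmon.unlock linextU. Qed.

Lemma psmon1 : psmon C mone = 1.
Proof. by rewrite psmon.unlock. Qed.

Lemma psmonM M N : psmon C (mmul M N) = psmon C M * psmon C N.
Proof. by rewrite psmon.unlock malgM_def fgmulUU mulr1. Qed.

Lemma psmon_ind (P : Lam -> Prop) : P 0 -> (forall M, P (psmon C M)) ->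
  (forall a f g, P f -> P g -> P (a *: f + g)) -> forall f, P f.
Proof. by move=> P0 PM PL; apply: malg_lin_ind => // M; have := PM M; rewrite psmon.unlock. Qed.

Lemma linext_coef (f : Lam) M :
  linext (fun N => (N == M)%:R : C^o) f = mcoeff M f.
Proof.
elim/psmon_ind: f => [|N|a f g Hf Hg]; first by rewrite linear0 mcoeff0.
  by rewrite linext_psmon psmon.unlock mcoeffU.
by rewrite linearP /= Hf Hg mcoeffD mcoeffZ.
Qed.

Lemma linext_sep (f : Lam) : (forall M, linext (fun N => (N == M)%:R : C^o) f = 0) -> f = 0.
Proof. by move=> H; apply/malgP => M; rewrite -linext_coef H mcoeff0. Qed.

Definition lam_psum_algebra (m : nat) (m_gt0 : (0 < m)%N) : psum_algebra C m :=
  @monomial_psum_algebra C m (Lam : comAlgType C) (psmon C) (fun V h => linext h) m_gt0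
    (fun V h => linext_is_linear h) linext_psmon psmon1 psmonM psmon_ind linext_sep.

Lemma lam_psum_algebra_form m (m_gt0 : (0 < m)%N) (f g : Lam) :
  @ps_form C m (lam_psum_algebra m_gt0) f g = jack_form m%:R f g.
Proof.
rewrite /= /mform (linextEw _ (fsubset_refl (msupp f))); apply: eq_bigr => M _.
by rewrite linext_coef -mulrA.
Qed.

End PolyInf.

(** * Fock space *)

(** In charge -p + K the mode a_i has creating degree (p - 1 - i) - (K - s). This is why a_i is
    recorded by e = p - 1 - i; a negative degree matches the zero value of [gs]. *)
Lemma mode_index (p K s i : nat) : (i < p)%N -> (s <= K)%N ->
  s%:Z - (- p%:Z + K%:Z) - i%:Z - 1 =
  if (K - s <= p.-1 - i)%N then Posz (p.-1 - i - (K - s)) else Negz (K - s - (p.-1 - i)).-1.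
Proof. by move=> ip sK; case: leqP => H; lia. Qed.

Section FockSpace.
Variable C : numClosedFieldType.
Local Notation FS := (fock_sum C).

Lemma linext_basis (V : lmodType C) (h : int * {cmonom nat} -> V) j M :
  linext h (basis_vec C j M) = h (j, M).
Proof. by rewrite basis_vec.unlock linextU. Qed.

Lemma fock_ind (P : FS -> Prop) : P 0 -> (forall j M, P (basis_vec C j M)) ->
  (forall a f g, P f -> P g -> P (a *: f + g)) -> forall f, P f.
Proof.
move=> P0 PB PL; apply: malg_lin_ind => // -[j M].
by have := PB j M; rewrite basis_vec.unlock.
Qed.

Variables (m : nat) (A : psum_algebra C m) (mon : {cmonom nat} -> A)
  (iota : int -> A -> FS).
Hypothesis m_gt0 : (0 < m)%N.
Local Notation L := (ps_alg A).
Local Notation pv := (ps_var A).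
Local Notation dp := (@ps_der C m A).
Local Notation gpol := (gpol A).
Local Notation Eop := (@Eop C m A).
Variable c : C.
Hypothesis c_ge0 : 0 <= c.
Hypothesis c2 : c * c *+ 2 = m%:R.
Hypothesis mon1 : mon mone = 1.
Hypothesis monU : forall i M, mon (mmul (ucm i) M) = pv i * mon M.
Hypothesis der_mon : forall n M, dp n (mon M) = (M n)%:R *: mon (divcm M (ucm n)).
Hypothesis mon_ind : forall P : L -> Prop, P 0 -> (forall M, P (mon M)) ->
  (forall a f g, P f -> P g -> P (a *: f + g)) -> forall f, P f.
Hypothesis iota_linear : forall j, linear (iota j).
Hypothesis iota_mon : forall j M, iota j (mon M) = c ^- mdeg M *: basis_vec C j M.

HB.instance Definition _ n := GRing.isLinear.Build C L L *:%R (dp n) (@ps_der_linear C m A n).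
HB.instance Definition _ j := GRing.isLinear.Build C L FS *:%R (iota j) (iota_linear j).
HB.instance Definition _ n := GRing.Linear.on (@heis C m n).
HB.instance Definition _ n := GRing.Linear.on (@mode C m n).

Let c_neq0 : c != 0.
Proof.
apply/eqP => c0; have /eqP := c2; rewrite c0 mul0r mul0rn eq_sym pnatr_eq0.
by rewrite (negPf (lt0n_neq0 m_gt0)).
Qed.

Let sqrt2m : sqrtC (2 * m)%:R = c *+ 2.
Proof.
have c0 : 0 <= c *+ 2 by rewrite mulrn_wge0 // sqrtC_ge0 divr_ge0 // ler0n.
rewrite -[RHS](sqrCK c0); congr sqrtC.
by rewrite expr2 mulrnAl mulrnAr c2 natrM mulr_natl.
Qed.

Lemma basis_iota j M : basis_vec C j M = iota j (c ^+ mdeg M *: mon M).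
Proof. by rewrite linearZZ /= iota_mon scalerA divff ?scale1r // expf_neq0. Qed.

Lemma iota_inj j : injective (iota j).
Proof.
pose g : FS -> L := linext (fun x => c ^+ mdeg x.2 *: mon x.2).
suff gK f : g (iota j f) = f by move=> f f' /(congr1 g); rewrite !gK.
elim/mon_ind: f => [|M|a f f' Hf Hf']; first by rewrite /g !linear0.
  rewrite iota_mon /g linearZZ /= linext_basis /= scalerA mulVf ?scale1r //.
  by rewrite expf_neq0.
by rewrite linearP /= /g linearP /= -!/(g _) Hf Hf'.
Qed.

Lemma heis_neg j n f : heis m (Negz n) (iota j f) = iota j (c *: (pv n * f)).
Proof.
elim/mon_ind: f => [|M|a f f' Hf Hf']; first by rewrite mulr0 scaler0 !linear0.
  rewrite -monU linearZZ /= iota_mon linearZZ /= [in LHS]/heis /= linext_basis /= iota_mon.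
  by rewrite mdegM mdegU exprS invfM scalerA mulrA (divff c_neq0) mul1r.
by rewrite mulrDr -scalerAr scalerDr scalerA mulrC -scalerA !linearP /= Hf Hf'.
Qed.

Lemma heis_pos j n f : heis m (Posz n.+1) (iota j f) = iota j ((n.+1%:R / c) *: dp n f).
Proof.
elim/mon_ind: f => [|M|a f f' Hf Hf']; first by rewrite !linear0 ?scaler0 ?linear0.
  rewrite der_mon scalerA linearZZ /= !iota_mon linearZZ /= [in LHS]/heis /= linext_basis /=.
  rewrite !scalerA natrM; have [->|Mn] := posnP (M n); first by rewrite !mulr0 !mul0r !scale0r.
  have -> : c ^- mdeg M = c^-1 * c ^- mdeg (divcm M (ucm n)).
    by rewrite -{1}(divcmK Mn) mdegM mdegU exprS invfM.
  have E (x y a b : C) : x / y * (a * b) = a * x * b / y by ring.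
  by rewrite E.
by rewrite !linearP /= Hf Hf'.
Qed.

Lemma heis_zero j f : heis m 0 (iota j f) = weight C m j *: iota j f.
Proof.
elim/mon_ind: f => [|M|a f f' Hf Hf']; first by rewrite !linear0.
  by rewrite iota_mon linearZZ /= [in LHS]/heis /= linext_basis /= !scalerA mulrC.
by rewrite !linearP /= Hf Hf'.
Qed.

Lemma creation_iota j n f : creation m n (iota j f) = iota j (creL n f).
Proof.
rewrite /creation; case: n => [|n]; first by rewrite /= linear0.
rewrite -[- (n.+1)%:Z]/(Negz n) heis_neg -linearZZ /= scalerA.
by rewrite sqrt2m (mulrAC (c *+ 2)) [c *+ 2 * c]mulrnAl c2.
Qed.

Lemma annihilation_iota j n f : annihilation m n (iota j f) = iota j (annL n f).
Proof.
rewrite /annihilation; case: n => [|n]; first by rewrite /= linear0.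
rewrite heis_pos -linearZZ /= scalerA.
have n0 : n.+1%:R != 0 :> C by rewrite pnatr_eq0.
by rewrite sqrt2m mulNr mulrA (divfK n0) mulrnAl (divff c_neq0).
Qed.

Lemma exp_creation_iota j n f : opser_exp (@creation C m) n (iota j f) = iota j (gpol n * f).
Proof.
rewrite -ser_exp_cre.
exact: (@ser_exp_intertwine _ _ _ (iota j) (@creL C m A) (@creation C m) (creation_iota j)).
Qed.

Lemma exp_annihilation_iota j n f :
  opser_exp (@annihilation C m) n (iota j f) = iota j (Eop n f).
Proof.
exact: (@ser_exp_intertwine _ _ _ (iota j) (@annL C m A) (@annihilation C m) (annihilation_iota j)).
Qed.

Lemma exp_iota j r s f : opser_exp (@creation C m) r (opser_exp (@annihilation C m) s (iota j f)) =
  iota j (gpol r * Eop s f).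
Proof.
exact: etrans (congr1 _ (exp_annihilation_iota j s f)) (exp_creation_iota j r (Eop s f)).
Qed.

Lemma Eop_mon M s : (mwgt M < s)%N -> Eop s (mon M) = 0.
Proof.
move: M s; apply: cmonom_ind => [s Ms|i M IH s]; first by rewrite mon1 Eop1 //; apply: leq_ltn_trans Ms.
by rewrite mwgtM mwgtU monU => Ms; apply: Eop_pvM IH _ Ms.
Qed.

Definition mode_term (n j : int) (s : nat) (f : L) : FS :=
  if s%:Z - j - n - 1 is Posz r then iota (j + (2 * m)%:Z) (gpol r * Eop s f) else 0.

Lemma mode_term_linear n j s : linear (mode_term n j s).
Proof.
move=> a f g; rewrite /mode_term; case: (_ - _) => r; last by rewrite scaler0 addr0.
by rewrite linearP /= mulrDr -scalerAr linearP.
Qed.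
HB.instance Definition _ n j s := GRing.isLinear.Build C L FS *:%R (mode_term n j s)
  (mode_term_linear n j s).

Lemma mode_term_eq0 n j s f : Eop s f = 0 -> mode_term n j s f = 0.
Proof. by rewrite /mode_term => ->; case: (_ - _) => r; rewrite ?mulr0 ?linear0. Qed.

Lemma sum_mode_term n j f B W : (B <= W)%N -> (forall s, (B <= s)%N -> Eop s f = 0) ->
  \sum_(s < W) mode_term n j s f = \sum_(s < B) mode_term n j s f.
Proof.
move=> BW H; rewrite [RHS](big_ord_widen W (fun s => mode_term n j s f)) // [RHS]big_mkcond.
by apply: eq_bigr => s _; case: ltnP => // /H /mode_term_eq0.
Qed.

(** The range of the sum in [mode] depends on the monomial; linearity in [f] appears only over a
    common, sufficiently large range. *)
Lemma mode_iota_wide n j f : exists W0, forall W, (W0 <= W)%N ->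
  mode m n (iota j f) = \sum_(s < W) mode_term n j s f.
Proof.
elim/mon_ind: f => [|M|a f g [W Hf] [W' Hg]].
- by exists 0%N => W _; rewrite !linear0 big1 // => s _; rewrite linear0.
- exists (mwgt M).+1 => W MW; rewrite (sum_mode_term _ _ MW); last exact: Eop_mon.
  rewrite iota_mon linearZZ /= [in LHS]/mode /= linext_basis /= scaler_sumr; apply: eq_bigr => s _.
  rewrite /mode_term; case: (_ - _) => r; last by rewrite scaler0.
  rewrite /shiftT linext_basis /= basis_iota exp_iota.
  rewrite !linearZZ /= -scalerAr linearZZ /= scalerA mulVf ?scale1r //.
  by rewrite expf_neq0.
- exists (maxn W W') => V; rewrite geq_max => /andP[WV W'V].
  rewrite !linearP /= (Hf V) // (Hg V) // scaler_sumr -big_split; apply: eq_bigr => s _ /=.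
  by rewrite linearP.
Qed.

(** For a word of length k, B = 2mk + 1 is admissible and gives the range of [lam_mode]. *)
Lemma mode_iota n j f B : (forall s, (B <= s)%N -> Eop s f = 0) ->
  mode m n (iota j f) = \sum_(s < B) mode_term n j s f.
Proof.
move=> H; have [W HW] := mode_iota_wide n j f.
rewrite (HW (maxn W B)) ?leq_maxl // (sum_mode_term _ _ _ H) //.
exact: leq_maxr.
Qed.

Variable p : nat.
Hypothesis p_gt0 : (0 < p)%N.

(** A word acts from its last letter on, hence [rev]: z_l belongs to the l-th mode applied, and the
    letter i gives the exponent p - 1 - i. *)
Definition wexp (w : seq 'I_p) (l : nat) : nat :=
  (p.-1 - nth 0%N (rev [seq nat_of_ord i | i <- w]) l)%N.

Lemma wexp_lt w l : (wexp w l < p)%N.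
Proof. by rewrite /wexp; lia. Qed.

Definition word_vec (w : seq 'I_p) : L := lam_word A (wexp w) (size w).

Lemma word_iota (w : seq 'I_p) :
  foldr (fun (i : 'I_p) v => mode m (i : nat)%:Z v) (vac C (- p%:Z)) w =
  iota (- p%:Z + (2 * m * size w)%:Z) (word_vec w).
Proof.
elim: w => [|i w IH] /=.
  by rewrite /word_vec /= muln0 addr0 /vac basis_iota mon1 mdeg1 expr0 scale1r.
rewrite IH /word_vec /=.
have -> : wexp (i :: w) (size w) = (p.-1 - i)%N.
  by rewrite /wexp /= rev_cons nth_rcons size_rev size_map ltnn eqxx.
have -> : lam_word A (wexp (i :: w)) (size w) = lam_word A (wexp w) (size w).
  apply: eq_lam_word => l lw.
  by rewrite /wexp /= rev_cons nth_rcons size_rev size_map lw.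
rewrite (@mode_iota _ _ _ (2 * m * size w).+1); last by move=> s; apply: Eop_lam_word.
rewrite /lam_mode linear_sum; apply: eq_bigr => s _ /=.
rewrite /mode_term /gs; set u := lam_word _ _ _.
have -> : - p%:Z + (2 * m * size w)%:Z + (2 * m)%:Z = - p%:Z + (2 * m * (size w).+1)%:Z.
  by rewrite mulnS PoszD; lia.
set K := (2 * m * size w)%N; have ip := ltn_ord i; have sK : (s <= K)%N by rewrite -ltnS.
rewrite (mode_index ip sK).
by case: leqP => H //; rewrite mul0r linear0.
Qed.

(** Vectors of V are combinations of words of all lengths; as each letter raises the charge by 2m,
    projecting to one charge selects one length. *)
Definition charge_proj (j : int) : FS -> FS :=
  linext (fun x => if x.1 == j then basis_vec C x.1 x.2 else 0).
HB.instance Definition _ j := GRing.Linear.on (charge_proj j).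

Lemma charge_proj_iota j j' f :
  charge_proj j (iota j' f) = if j' == j then iota j' f else 0.
Proof.
elim/mon_ind: f => [|M|a f g Hf Hg]; first by rewrite !linear0 if_same.
  rewrite iota_mon linearZZ /= [in LHS]/charge_proj linext_basis /=.
  by case: eqP => _; rewrite ?scaler0.
by rewrite !linearP /= Hf Hg; case: eqP => _; rewrite ?scaler0 ?addr0.
Qed.

Lemma mcoeffP x a (f g : FS) : mcoeff x (a *: f + g) = a * mcoeff x f + mcoeff x g.
Proof. by rewrite mcoeffD mcoeffZ. Qed.

Lemma mcoeff_basis x j M : mcoeff x (basis_vec C j M) = ((j, M) == x)%:R.
Proof. by rewrite basis_vec.unlock mcoeffU. Qed.

Lemma mcoeff_heis_zero x v : mcoeff x (heis m 0 v) = weight C m x.1 * mcoeff x v.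
Proof.
elim/fock_ind: v => [|j M|a f g Hf Hg]; first by rewrite linear0 mcoeff0 mulr0.
  rewrite [in LHS]/heis /= linext_basis /= mcoeffZ mcoeff_basis.
  by case: eqP => [<-|]; rewrite ?mulr0.
rewrite linearP /=; move: (heis m 0 f) (heis m 0 g) Hf Hg => F G Hf Hg.
by rewrite !mcoeffP Hf Hg mulrDr mulrCA.
Qed.

Lemma mcoeff_charge_proj x j v :
  mcoeff x (charge_proj j v) = if x.1 == j then mcoeff x v else 0.
Proof.
elim/fock_ind: v => [|j' M|a f g Hf Hg]; first by rewrite linear0 mcoeff0 if_same.
  rewrite [in LHS]/charge_proj /= linext_basis /=.
  case: x => i M'; rewrite (fun_if (mcoeff _)) mcoeff0 mcoeff_basis /=.
  have [[-> _]|] := eqVneq (j', M) (i, M'); first by [].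
  by rewrite !if_same.
rewrite linearP /=; move: (charge_proj j f) (charge_proj j g) Hf Hg => F G Hf Hg.
rewrite !mcoeffP Hf Hg.
by case: eqP => _; rewrite ?mulr0 ?addr0.
Qed.

Let sqrt2m_neq0 : sqrtC (2 * m)%:R != 0 :> C.
Proof. by rewrite sqrtC_eq0 pnatr_eq0 muln_eq0 -lt0n m_gt0. Qed.

Lemma weight_inj : injective (weight C m).
Proof.
move=> i j; rewrite /weight => /(mulIf _) H.
by apply: (intr_inj (R := C)); apply: H; rewrite invr_eq0.
Qed.

(** Distinct charges have distinct h_0-eigenvalues, so an eigenvector has no component outside its
    own charge. *)
Lemma charge_proj_eigen j v : heis m 0 v = weight C m j *: v -> charge_proj j v = v.
Proof.
move=> Hv; apply/malgP => x; rewrite mcoeff_charge_proj; case: eqP => // xj.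
have /eqP := congr1 (mcoeff x) Hv; rewrite mcoeff_heis_zero mcoeffZ -subr_eq0 -mulrBl.
rewrite mulf_eq0 subr_eq0 (inj_eq weight_inj) => /orP[/eqP //|/eqP ->].
by [].
Qed.

Variable J : intpart -> L.
Hypothesis J_tri : forall l, exists (s : seq intpart) (c : intpart -> C),
     (forall u, u \in s -> dominates l u /\ u <> l) /\
     forall n, @ps_ev C m A n (J l) = msymn C n l + \sum_(u <- s) c u *: msymn C n u.
Hypothesis J_orth : forall l u, l <> u -> @ps_form C m A (J l) (J u) = 0.
Variable k : nat.
Local Notation top := (- p%:Z + (2 * m * k)%:Z).

Lemma weight_top : weight C m top =
  - p%:R / sqrtC (2 * m)%:R + k%:R * sqrtC (2 * m)%:R.
Proof.
rewrite /weight rmorphD rmorphN /= -!pmulrn mulrDl; congr (_ + _).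
apply: (mulIf sqrt2m_neq0); rewrite divfK // -mulrA -expr2 sqrtCK -natrM.
by rewrite mulnC.
Qed.

Lemma wexp_surj (e : mpoly.multinom k) : (forall l, (e l < p)%N) ->
  exists w : k.-tuple 'I_p, forall l : 'I_k, wexp w l = e l.
Proof.
move=> ep; pose f (l : 'I_k) : 'I_p := insubd (Ordinal p_gt0) (p.-1 - e l)%N.
exists [tuple of rev [tuple f l | l < k]] => l.
rewrite /wexp /= map_rev revK (nth_map (Ordinal p_gt0)); last first.
  by rewrite size_map ?size_enum_ord // -enumT size_enum_ord.
rewrite (nth_map l); last by rewrite ?size_enum_ord // -enumT size_enum_ord.
rewrite -?enumT nth_ord_enum.
rewrite val_insubd; have -> : (p.-1 - e l < p)%N by lia.
by rewrite subKn // -ltnS prednK.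
Qed.

Lemma word_vec_rect (w : seq 'I_p) : size w = k -> rect_vec J p k (word_vec w).
Proof. by rewrite /word_vec => ->; apply: lam_word_rect => // l; apply: wexp_lt. Qed.

Theorem fock_jack_basis :
  is_basis (in_rect (p%:Z - (k%:Z - 1) * m%:Z - 1) k) (fun u => iota top (J u))
    (Vweight m p (- p%:R / sqrtC (2 * m)%:R + k%:R * sqrtC (2 * m)%:R)).
Proof.
rewrite -weight_top; split.
- move=> u uN; split; last by rewrite heis_zero.
  pose v (w : k.-tuple 'I_p) := word_vec w.
  have vR w : rect_vec J p k (v w) by apply: word_vec_rect; rewrite size_tuple.
  have [|b ->] := jack_rect_span m_gt0 J_tri J_orth vR _ uN.
    move=> f vf degf; apply: (@vdm_sqr_faithful C k m p) => // e ep.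
    have [w we] := wexp_surj ep; have := vf w.
    rewrite /v /word_vec size_tuple lam_wordE form_Phi // => E.
    rewrite -[RHS]E; congr (mpoly.mcoeff _ _).
    by apply/mpoly.mnmP => l; rewrite mpoly.mnmE.
  exists #|{: k.-tuple 'I_p}|, (fun i => b (enum_val i)),
    (fun i => iota top (v (enum_val i))); split=> [i|].
    by exists (enum_val i); rewrite word_iota size_tuple.
  rewrite linear_sum (reindex _ (onW_bij _ (enum_val_bij _))) /=.
  by apply: eq_bigr => i _; rewrite linearZZ.
- move=> s a us sN H; apply: (jack_indep m_gt0 J_tri us) => u us'.
  have -> : \sum_(l <- s) a l *: J l = 0.
    apply: (@iota_inj top); rewrite linear0 linear_sum -[RHS]H.
    by apply: eq_bigr => l _; rewrite linearZZ.
  by rewrite ps_form_sym form0l.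
move=> _ [[n [a [x [xw ->]]]] /charge_proj_eigen <-].
have [w wE] := fin_all_exists xw.
(* Words of length other than k are replaced by 0, as the projection to charge [top] kills them; m >
   0 makes the charge determine the length. *)
pose y := \sum_(i < n) a i *: (if size (w i) == k then word_vec (w i) else 0).
have yR : rect_vec J p k y.
  apply: rect_vec_sum => i; case: eqP => [|_]; [exact: word_vec_rect | exact: rect_vec0].
have -> : charge_proj top (\sum_(i < n) a i *: x i) = iota top y.
  rewrite !linear_sum; apply: eq_bigr => i _ /=.
  rewrite !linearZZ /= wE word_iota charge_proj_iota.
  have -> : (- p%:Z + (2 * m * size (w i))%:Z == top) = (size (w i) == k).
    by rewrite (inj_eq (addrI _)) eqz_nat eqn_pmul2l // muln_gt0.
  by rewrite (fun_if (iota top)) linear0; case: eqP => [->|_].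
have [s [b [us sN yE]]] := rect_vec_span m_gt0 J_tri J_orth yR.
exists s, b; split=> //; rewrite yE linear_sum.
by apply: eq_bigr => l _; rewrite linearZZ.
Qed.

End FockSpace.

(** * The algebra of power sums and the isomorphism I, with c = sqrt(m/2) *)

Section Instance.
Variables (C : numClosedFieldType) (m : nat).
Hypothesis m_gt0 : (0 < m)%N.
Local Notation A := (lam_psum_algebra C m_gt0).

Definition fock_embed (j : int) (f : poly_inf C) : fock_sum C := in_charge j (symIinv m f).

Lemma fock_embed_linear j : linear (fock_embed j).
Proof.
move=> a f g; rewrite /fock_embed /in_charge /symIinv.
by rewrite (linext_is_linear _ a f g) (linext_is_linear _ a).
Qed.

Lemma fock_embed_mon j M :
  fock_embed j (psmon C M) = sqrtC (m%:R / 2%:R) ^- mdeg M *: basis_vec C j M.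
Proof.
rewrite /fock_embed /symIinv linext_psmon /in_charge.
have -> : << M >> = psmon C M by rewrite psmon.unlock.
by rewrite linearZZ /= linext_psmon.
Qed.

Lemma lam_fock_jack_basis (p k : nat) (J : intpart -> poly_inf C) :
  (0 < p)%N -> is_jack m%:R J ->
  is_basis (in_rect (p%:Z - (k%:Z - 1) * m%:Z - 1) k)
    (fun u => fock_embed (- p%:Z + (2 * m * k)%:Z) (J u))
    (Vweight m p
       (- p%:R / sqrtC (2 * m)%:R + k%:R * sqrtC (2 * m)%:R)).
Proof.
move=> p_gt0 [J_tri J_orth].
apply: (@fock_jack_basis C m A (psmon C) fock_embed m_gt0 (sqrtC (m%:R / 2%:R))) => //.
- by rewrite sqrtC_ge0 divr_ge0 // ler0n.
- by rewrite -expr2 sqrtCK -mulr_natr divfK // pnatr_eq0.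
- exact: psmon1.
- by move=> i M; exact: psmonM.
- by move=> n M; exact: linext_psmon.
- exact: psmon_ind.
- exact: fock_embed_linear.
- exact: fock_embed_mon.
- by move=> l u lu; rewrite lam_psum_algebra_form; exact: J_orth.
Qed.

End Instance.

Theorem theorem2p2 (R : realType) (m p k : nat) (hm : (0 < m)%N) (hp : (0 < p)%N)
    (J : intpart -> poly_inf R[i]) (hJ : is_jack m%:R J) :
  is_basis (in_rect (p%:Z - (k%:Z - 1) * m%:Z - 1) k)
    (fun u => in_charge (- p%:Z + (2 * m * k)%:Z) (symIinv m (J u)))
    (Vweight m p
       (- p%:R / sqrtC (2 * m)%:R + k%:R * sqrtC (2 * m)%:R)).
Proof.
exact: lam_fock_jack_basis.
Qed.
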